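(* Let $h$ be the free Haar trace on $U\langle n\rangle$. For each $N\ge1$ let $U^{(N)}$ be a Haar-distributed (uniform) random unitary matrix in $U(N)$. Then the $N\times N$ blocks $([U^{(nN)}]_{ij})_{1\le i,j\le n}$ converge almost surely in $*$-distribution to $(u_{ij})_{1\le i,j\le n}$ in $(U_n^{nc},h)$ as $N\to\infty$; i.e. for every noncommutative polynomial $P$ in $n^2$ variables and their adjoints, almost surely $\mathrm{tr}_N\big(P([U^{(nN)}]_{ij})\big)\to h\big(P(u_{ij})\big)$.
   Context: $U_n^{nc}$ is the universal unital $*$-algebra generated by $u_{ij}$ ($1\le i,j\le n$) with $\sum_ku_{ki}^*u_{kj}=\delta_{ij}=\sum_ku_{ik}u_{jk}^*$, with $\Delta(u_{ij})=\sum_ku_{ik}^{(1)}u_{kj}^{(2)}$ into the free product $U_n^{nc}\sqcup U_n^{nc}$, $\delta(u_{ij})=\delta_{ij}$. The free convolution of states is $\phi\star_F\psi=(\phi*\psi)\circ\Delta$ ($\phi*\psi$ the free product state); the free Haar trace is the tracial state $h$ with $\phi\star_Fh=h=h\star_F\phi$ for all tracial states $\phi$. For $M\in M_{nN}(\mathbb C)$, $[M]_{ij}$ is its $(i,j)$-th $N\times N$ block; $\mathrm{tr}_N=\frac1N\mathrm{Tr}$. *)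

(* Defs.v *)
From HB Require Import structures.
From mathcomp Require Import all_boot all_order all_algebra.
From mathcomp Require Import complex.
From mathcomp Require Import all_classical all_reals.
From mathcomp Require Import measure lebesgue_measure probability.

Set Implicit Arguments.
Unset Strict Implicit.
Unset Printing Implicit Defensive.

Import Order.TTheory GRing.Theory Num.Theory.
Local Open Scope ring_scope.
Local Open Scope classical_set_scope.

Section FreeHaar.
Variable R : realType.
Local Notation C := (R[i]).

(* A letter of the free *-algebra on the u_ij is (i, j, s): it stands   *)
(* for u_ij if s = false and for u_ij^* if s = true.                    *)
(* A noncommutative *-polynomial over a letter type T is a formal       *)
(* linear combination of words, represented as a list of                *)
(* (coefficient, word) pairs.                                           *)
Definition ltr (n : nat) : Type := ('I_n * 'I_n * bool)%type.

Definition ncpoly (T : Type) := seq (C * seq T).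

Definition pmono (T : Type) (w : seq T) : ncpoly T := [:: (1, w)].
Definition pconst (T : Type) (c : C) : ncpoly T := [:: (c, [::])].

Definition pmul (T : Type) (p q : ncpoly T) : ncpoly T :=
  [seq (x.1 * y.1, x.2 ++ y.2) | x <- p, y <- q].

Definition pprod (T : Type) (ps : seq (ncpoly T)) : ncpoly T :=
  foldr (@pmul T) (pmono [::]) ps.

Definition padj (T : Type) (st : T -> T) (p : ncpoly T) : ncpoly T :=
  [seq (conjc x.1, rev (map st x.2)) | x <- p].

Definition pmap (T T' : Type) (f : T -> T') (p : ncpoly T) : ncpoly T' :=
  [seq (x.1, map f x.2) | x <- p].

(* a linear functional on the free *-algebra is given by its values on
   words; [app m p] is its value on the polynomial p *)
Definition app (T : Type) (m : seq T -> C) (p : ncpoly T) : C :=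
  \sum_(x <- p) x.1 * m x.2.

Definition star_ltr n (l : ltr n) : ltr n := (l.1, ~~ l.2).

(* The defining relations of U_n^{nc}:                                  *)
(*   rel1 i j = sum_k u_ki^* u_kj - delta_ij,                           *)
(*   rel2 i j = sum_k u_ik u_jk^* - delta_ij.                           *)
Definition delta n (i j : 'I_n) : C := (i == j)%:R.

Definition rel1 n (i j : 'I_n) : ncpoly (ltr n) :=
  [seq (1, [:: (k, i, true); (k, j, false)]) | k <- enum 'I_n]
  ++ pconst _ (- delta i j).

Definition rel2 n (i j : 'I_n) : ncpoly (ltr n) :=
  [seq (1, [:: (i, k, false); (j, k, true)]) | k <- enum 'I_n]
  ++ pconst _ (- delta i j).

(* A linear functional on the free *-algebra over letters T factors
   through the quotient by the two-sided ideal generated by the images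
   emb (rel1 i j), emb (rel2 i j) iff it kills all a * r * b, a b words. *)
Definition kills_rels n (T : Type) (emb : ltr n -> T) (m : seq T -> C) :=
  forall (a b : seq T) (i j : 'I_n),
    app m (pprod [:: pmono a; pmap emb (rel1 i j); pmono b]) = 0 /\
    app m (pprod [:: pmono a; pmap emb (rel2 i j); pmono b]) = 0.

(* Linear functionals on U_n^{nc} = functionals on the free *-algebra
   killing the defining ideal. *)
Definition Unc_functional n (m : seq (ltr n) -> C) := kills_rels id m.

Definition is_state n (m : seq (ltr n) -> C) :=
  [/\ Unc_functional m,
      m [::] = 1 &
      forall p : ncpoly (ltr n),
        0 <= app m (pmul (padj (@star_ltr n) p) p)].

Definition is_tracial n (m : seq (ltr n) -> C) :=
  forall a b : seq (ltr n), m (a ++ b) = m (b ++ a).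

(* The free product U_n^{nc} ⊔ U_n^{nc}: letters (l, c), c = false for  *)
(* the first copy (superscript (1)), c = true for the second copy.      *)
Definition ltr2 n : Type := (ltr n * bool)%type.
Definition emb n (c : bool) (l : ltr n) : ltr2 n := (l, c).

(* omega is the free product state phi * psi on U_n^{nc} ⊔ U_n^{nc}:
   a linear functional on the free product algebra, restricting to phi
   and psi on the two copies, for which the two copies are free. *)
Definition is_free_product n (phi psi : seq (ltr n) -> C)
    (omega : seq (ltr2 n) -> C) :=
  [/\ kills_rels (@emb n false) omega,
      kills_rels (@emb n true) omega,
      (forall w, omega (map (@emb n false) w) = phi w),
      (forall w, omega (map (@emb n true) w) = psi w) &
      (forall ps : seq (bool * ncpoly (ltr n)),
         ps != [::] ->
         (forall k, (k.+1 < size ps)%N ->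
            (nth (false, [::]) ps k).1 != (nth (false, [::]) ps k.+1).1) ->
         (forall x, x \in ps -> app omega (pmap (@emb n x.1) x.2) = 0) ->
         app omega (pprod [seq pmap (@emb n x.1) x.2 | x <- ps]) = 0)].

(* The comultiplication Delta(u_ij) = sum_k u_ik^(1) u_kj^(2), extended
   as a unital *-homomorphism to words. *)
Definition Delta_ltr n (l : ltr n) : ncpoly (ltr2 n) :=
  let: (i, j, s) := l in
  if ~~ s then
    [seq (1, [:: ((i, k, false), false); ((k, j, false), true)])
    | k <- enum 'I_n]
  else
    [seq (1, [:: ((k, j, true), true); ((i, k, true), false)])
    | k <- enum 'I_n].

Definition Delta n (w : seq (ltr n)) : ncpoly (ltr2 n) :=
  pprod (map (@Delta_ltr n) w).

Definition is_free_conv n (phi psi chi : seq (ltr n) -> C) :=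
  exists omega, is_free_product phi psi omega /\
    forall w, chi w = app omega (Delta w).

Definition is_free_Haar_trace n (h : seq (ltr n) -> C) :=
  [/\ is_state h, is_tracial h &
      forall phi, is_state phi -> is_tracial phi ->
        is_free_conv phi h h /\ is_free_conv h phi h].

Definition adjmx N (X : 'M[C]_N) : 'M[C]_N := (map_mx conjc X)^T.

Definition unitary N (X : 'M[C]_N) :=
  X *m adjmx X = 1%:M /\ adjmx X *m X = 1%:M.

Definition ntr N (X : 'M[C]_N) : C := \tr X / N%:R.

Definition block n N (M : 'M[C]_(n * N)) (i j : 'I_n) : 'M[C]_N :=
  \matrix_(a < N, b < N) M (mxvec_index i a) (mxvec_index j b).

Definition eval_ltr n N (X : 'I_n -> 'I_n -> 'M[C]_N) (l : ltr n) :=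
  let: (i, j, s) := l in if s then adjmx (X i j) else X i j.

Definition eval_word n N (X : 'I_n -> 'I_n -> 'M[C]_N) (w : seq (ltr n)) :=
  foldr (fun l acc => eval_ltr X l *m acc) 1%:M w.

Definition ntr_poly n N (X : 'I_n -> 'I_n -> 'M[C]_N) (p : ncpoly (ltr n)) :=
  \sum_(x <- p) x.1 * ntr (eval_word X x.2).

(* Borel sigma-algebra on M_N(C) = C^{N^2} = R^{2 N^2}: generated by the
   real and imaginary parts of the entries. *)
Definition mx_coord_sets N : set (set 'M[C]_N) :=
  [set A | exists (i j : 'I_N) (b : bool) (B : set R),
     measurable B /\
     A = (fun X : 'M[C]_N => (if b then complex.Im (X i j)
                                   else complex.Re (X i j))) @^-1` B].

Definition mx_borel N (A : set 'M[C]_N) := <<s @mx_coord_sets N >> A.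

(* U is a Haar-distributed random unitary matrix: a measurable map with
   values in U(N) whose law is the (unique) left-invariant probability
   measure on U(N), i.e. Haar measure. *)
Definition Haar_distributed d (Omega : measurableType d)
    (P : probability Omega R) N (U : Omega -> 'M[C]_N) :=
  [/\ forall w, unitary (U w),
      forall A, mx_borel A -> measurable (U @^-1` A) &
      forall V : 'M[C]_N, unitary V -> forall A, mx_borel A ->
        P (U @^-1` A) = P ((fun w => V *m U w) @^-1` A)].

End FreeHaar.

(* Main.v *)
Require Import Defs.
From HB Require Import structures.
From mathcomp Require Import all_boot all_order all_algebra.
From mathcomp Require Import complex zify ring lra.
From mathcomp Require Import all_classical all_reals.
From mathcomp Require Import ereal topology normedtype sequences.
From mathcomp Require Import measure lebesgue_measure measurable_realfun.
From mathcomp Require Import lebesgue_integral probability.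
Import Defs.

(** Both sides are governed by the same Schwinger-Dyson equation.  Let D_pq be
    the derivation of U_n^nc with values in U_n^nc (x) U_n^nc given by
    D_pq u_ij = delta_ip 1 (x) u_qj and D_pq u_ij^* = - delta_iq u_pj^* (x) 1.
    A tracial state m with (m (x) m) o D_pq = 0 for all p, q is unique, because
    summing the equation at u_pj w over p expresses n m(u_qj w) through moments
    of shorter words.

    For Haar unitaries of size nN, differentiating the left invariance of
    E[w_ab tr(w_1) ... tr(w_k)] along matrix units gives this equation for
    E[tr(w_0) tr(w_1) ... tr(w_k)] up to O(1/N^2).  Hence these expectations
    converge at rate O(1/N^2), the limits factorize, and mu(w) = lim E[tr(w)] is
    a tracial state solving the equation.

    The derivation lifts to the first factor of the free product of mu and h:
    it kills every centered alternating product except those of length one, on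
    which it reduces to the equation for mu.  As Delta intertwines the two
    derivations, h = mu * h solves the equation as well, so h = mu.  Finally
    E|tr(w) - mu(w)|^2 = O(1/N^2) is summable, which gives almost sure
    convergence. *)

Set Implicit Arguments.
Unset Strict Implicit.
Unset Printing Implicit Defensive.
Import Order.TTheory GRing.Theory Num.Theory numFieldNormedType.Exports.
Local Open Scope ring_scope.
Local Open Scope classical_set_scope.

(** Absorption is required only against tracial states, so it says something about [h] only once a
    tracial state solving the equation is at hand; the matrices supply one, and no formula for the
    moments of [h] is used. For a single trace the matrix equation does not close, since
    differentiating a word produces the expectation of a product of two traces. Hence the induction
    runs over lists of words, that is, products of traces. Differentiating the word whose matrix
    entry is taken yields N^2 tr(x) tr(y), while differentiating another trace merges it with that
    word into one bounded trace without a factor N^2; this is the source of 1/N^2. The rate is built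
    into the notion of limit because the final variance bound has to be summable. Two obstacles
    shape the matrix side. Matrix units are not skew-adjoint, so the derivative is defined
    complex-linearly in its direction and units are written as combinations of skew-adjoint
    matrices. Differentiation under the expectation is replaced by a second-order bound, uniform
    over the unitaries, for polynomials along explicit unitary curves. *)

Section PolynomialArithmetic.
Variables (R : realType) (T : Type).
Local Notation C := R[i].
Implicit Types (p q r : ncpoly R T) (m : seq T -> C).

Lemma app_nil m : app m [::] = 0.
Proof. by rewrite /app big_nil. Qed.

Lemma app_cat m p q : app m (p ++ q) = app m p + app m q.
Proof. by rewrite /app big_cat. Qed.

Lemma app_pmono m w : app m (pmono R w) = m w.
Proof. by rewrite /app big_seq1 mul1r. Qed.

Lemma app_pconst m (c : C) : app m (pconst T c) = c * m [::].
Proof. by rewrite /app big_seq1. Qed.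

Lemma eq_app m1 m2 p : m1 =1 m2 -> app m1 p = app m2 p.
Proof. by move=> e; apply: eq_bigr => x _; rewrite e. Qed.

Lemma app_pmul m p q :
  app m (pmul p q) = app (fun x => app (fun y => m (x ++ y)) q) p.
Proof.
rewrite /app /pmul big_allpairs_dep; apply: eq_bigr => x _.
by rewrite big_distrr; apply: eq_bigr => y _ /=; rewrite mulrA.
Qed.

Lemma pmul_cons x p q :
  pmul (x :: p) q = [seq (x.1 * y.1, x.2 ++ y.2) | y <- q] ++ pmul p q.
Proof. by []. Qed.

Lemma pmul_catl p q r : pmul (p ++ q) r = pmul p r ++ pmul q r.
Proof. by rewrite /pmul allpairs_cat. Qed.

Lemma pmulA p q r : pmul p (pmul q r) = pmul (pmul p q) r.
Proof.
elim: p => //= x p IH; rewrite !pmul_cons pmul_catl -IH; congr (_ ++ _).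
elim: q {IH} => //= y q IHq; rewrite !pmul_cons map_cat IHq; congr (_ ++ _).
by rewrite -map_comp; apply: eq_map => z /=; rewrite mulrA catA.
Qed.

Lemma pmul1l q : pmul (pmono R [::]) q = q.
Proof.
by rewrite pmul_cons cats0; elim: q => //= -[c w] q ->; rewrite mul1r.
Qed.

Lemma pmul1r q : pmul q (pmono R [::]) = q.
Proof. by elim: q => //= -[c w] q IH; rewrite pmul_cons IH /= mulr1 cats0. Qed.

Lemma pprod_cat (ps qs : seq (ncpoly R T)) :
  pprod (ps ++ qs) = pmul (pprod ps) (pprod qs).
Proof. by elim: ps => [|p ps IH] /=; rewrite ?pmul1l // IH pmulA. Qed.

Lemma pmap_pmul (T' : Type) (f : T -> T') p q :
  pmap f (pmul p q) = pmul (pmap f p) (pmap f q).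
Proof.
elim: p => //= x p IH; rewrite !pmul_cons {1}/pmap map_cat; congr (_ ++ _) => //.
by rewrite /pmap -!map_comp; apply: eq_map => y /=; rewrite map_cat.
Qed.

Lemma app_pmap (T' : Type) (f : T -> T') (m : seq T' -> C) p :
  app m (pmap f p) = app (fun w => m (map f w)) p.
Proof. by rewrite /app /pmap big_map. Qed.

Lemma app_exchange (T' : Type) (F : seq T -> seq T' -> C) p (q : ncpoly R T') :
  app (fun x => app (F x) q) p = app (fun y => app (F^~ y) p) q.
Proof.
rewrite /app; under eq_bigr do rewrite big_distrr /=.
rewrite exchange_big; apply: eq_bigr => y _; rewrite big_distrr /=.
by apply: eq_bigr => x _; rewrite mulrCA.
Qed.

Lemma app0 p : app (fun=> 0) p = 0.
Proof. by rewrite /app big1 // => x _; rewrite mulr0. Qed.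

Lemma app_eq0 m p : (forall w, m w = 0) -> app m p = 0.
Proof. by move=> m0; rewrite (eq_app _ m0) app0. Qed.

Lemma app_linear m1 m2 (c : C) p :
  app (fun w => c * m1 w + m2 w) p = c * app m1 p + app m2 p.
Proof.
rewrite /app big_distrr -big_split; apply: eq_bigr => x _ /=.
by rewrite mulrDr !mulrA [_ * c]mulrC.
Qed.

End PolynomialArithmetic.

(** * Formal derivatives *)

Section Derivation.
Variables (R : realType) (T : Type).
Local Notation C := R[i].
Local Notation tensor := (seq (C * (seq T * seq T))).
Variable dl : T -> tensor.
Implicit Types (B : seq T -> seq T -> C) (s : tensor).

Definition bisum B s := \sum_(x <- s) x.1 * B x.2.1 x.2.2.

(* The Leibniz extension of [dl] to a derivation from the free algebra A
   to the bimodule A (x) A. *)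
Fixpoint der (w : seq T) : tensor :=
  if w is l :: w' then
    [seq (x.1, (x.2.1, x.2.2 ++ w')) | x <- dl l]
    ++ [seq (x.1, (l :: x.2.1, x.2.2)) | x <- der w']
  else [::].

Lemma eq_bisum B1 B2 s : (forall x y, B1 x y = B2 x y) -> bisum B1 s = bisum B2 s.
Proof. by move=> e; apply: eq_bigr => x _; rewrite e. Qed.

Lemma bisum_cat B s1 s2 : bisum B (s1 ++ s2) = bisum B s1 + bisum B s2.
Proof. by rewrite /bisum big_cat. Qed.

Lemma bisum0 B s : (forall x y, B x y = 0) -> bisum B s = 0.
Proof. by move=> e; rewrite /bisum big1 // => x _; rewrite e mulr0. Qed.

Lemma bisum_der_cons B l w :
  bisum B (der (l :: w)) =
  bisum (fun x y => B x (y ++ w)) (dl l) + bisum (fun x y => B (l :: x) y) (der w).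
Proof. by rewrite /= bisum_cat /bisum !big_map. Qed.

Lemma bisum_der_cat B v w :
  bisum B (der (v ++ w)) =
  bisum (fun x y => B x (y ++ w)) (der v) + bisum (fun x y => B (v ++ x) y) (der w).
Proof.
elim: v B => [|l v IH] B; first by rewrite /= [in RHS]/bisum big_nil add0r.
rewrite cat_cons !bisum_der_cons IH addrA; congr (_ + _ + _).
by apply: eq_bisum => x y; rewrite catA.
Qed.

Lemma bisum_app_l (F : seq T -> seq T -> seq T -> C) p s :
  bisum (fun x y => app (F x y) p) s = app (fun z => bisum (fun x y => F x y z) s) p.
Proof.
rewrite /bisum /app; under eq_bigr do rewrite big_distrr /=.
rewrite exchange_big; apply: eq_bigr => z _; rewrite big_distrr /=.
by apply: eq_bigr => x _; rewrite mulrCA.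
Qed.

(** Leibniz rule for polynomials: the undifferentiated factor is absorbed into the adjacent leg of
    the tensor. *)
Lemma app_der_pmul B (p q : ncpoly R T) :
  app (fun w => bisum B (der w)) (pmul p q) =
  app (fun w => bisum (fun x y => app (fun z => B x (y ++ z)) q) (der w)) p
  + app (fun w => bisum (fun x y => app (fun z => B (z ++ x) y) p) (der w)) q.
Proof.
rewrite app_pmul.
under eq_app => v.
  have -> : app (fun w => bisum B (der (v ++ w))) q =
    app (fun w => bisum (fun x y => B x (y ++ w)) (der v)) q +
    app (fun w => bisum (fun x y => B (v ++ x) y) (der w)) q.
    rewrite /app -big_split; apply: eq_bigr => w _ /=.
    by rewrite bisum_der_cat mulrDr.
  over.
rewrite {1}/app; under eq_bigr do rewrite mulrDr.
rewrite big_split /=; congr (_ + _).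
  by apply: eq_bigr => v _; rewrite bisum_app_l.
rewrite /app.
under eq_bigr do rewrite big_distrr /=.
rewrite exchange_big; apply: eq_bigr => w _.
rewrite (bisum_app_l (fun x y z => B (z ++ x) y)) /app big_distrr /=.
by apply: eq_bigr => v _; rewrite mulrCA.
Qed.

End Derivation.

(** * Freeness *)

Section Freeness.
Variables (R : realType) (n : nat).
Local Notation C := R[i].
Local Notation L := (ltr n).
Local Notation L2 := (ltr2 n).
Implicit Types (om : seq L2 -> C) (ps : seq (bool * ncpoly R L)).

Definition colored (x : bool * ncpoly R L) : ncpoly R L2 := pmap (@emb n x.1) x.2.
Definition colored_prod ps := pprod (map colored ps).
Definition color_neq (x y : bool * ncpoly R L) := x.1 != y.1.
Definition centered om x := app om (colored x) = 0.

Lemma colored_prod_cat ps qs :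
  colored_prod (ps ++ qs) = pmul (colored_prod ps) (colored_prod qs).
Proof. by rewrite /colored_prod map_cat pprod_cat. Qed.

Lemma colored_prod_cons x ps :
  colored_prod (x :: ps) = pmul (colored x) (colored_prod ps).
Proof. by []. Qed.

Lemma colored_prod1 x : colored_prod [:: x] = colored x.
Proof. by rewrite colored_prod_cons pmul1r. Qed.

Definition centering om (x : bool * ncpoly R L) : bool * ncpoly R L :=
  (x.1, x.2 ++ pconst L (- app om (colored x))).

Lemma colored_centering om x :
  colored (centering om x) = colored x ++ pconst _ (- app om (colored x)).
Proof. by rewrite /colored /pmap map_cat. Qed.

Lemma centered_centering om x : om [::] = 1 -> centered om (centering om x).
Proof.
by move=> h1; rewrite /centered colored_centering app_cat app_pconst h1 mulr1 subrr.
Qed.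

Lemma app_pmul_centering om (F : seq L2 -> C) A x D :
  app F (pmul A (pmul (colored x) D)) =
  app F (pmul A (pmul (colored (centering om x)) D))
  + app om (colored x) * app F (pmul A D).
Proof.
rewrite colored_centering pmul_catl app_pmul [in X in _ = X + _]app_pmul.
rewrite [app F (pmul A D)]app_pmul addrC -app_linear; apply: eq_app => a.
rewrite app_cat [app _ (pmul (pconst _ _) _)]app_pmul app_pconst /=.
by rewrite mulNr addrCA subrr addr0.
Qed.

(* Centered alternating products together with the constants span the free
   product, so they detect linear functionals. *)
Lemma functional_eq0 om (F : seq L2 -> C) : om [::] = 1 -> F [::] = 0 ->
  (forall ps, ps != [::] -> sorted color_neq ps ->
     (forall x, x \in ps -> centered om x) -> app F (colored_prod ps) = 0) ->
  forall w, F w = 0.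
Proof.
move=> om1 F1 Fc.
(* [ps] is already centered and alternating, [qs] is arbitrary. If the next factor [b] differs in
   color from the last one of [ps], center it; the correction drops [b] and is shorter. If the
   colors agree, multiply the two, which lowers the total length by one. *)
have main k : forall qs ps, (size ps + size qs <= k)%N -> sorted color_neq ps ->
    (forall x, x \in ps -> centered om x) -> app F (colored_prod (ps ++ qs)) = 0.
  elim: k => [|k IHk].
    move=> qs ps; rewrite leqn0 addn_eq0 => /andP[/nilP -> /nilP ->] _ _.
    by rewrite app_pmono.
  elim=> [|b qs IHq] ps le_k sps cps.
    rewrite cats0; have [->|ps0] := eqVneq ps [::]; first by rewrite app_pmono.
    exact: Fc.
  have center_b : sorted color_neq (rcons ps b) -> app F (colored_prod (ps ++ b :: qs)) = 0.
    move=> sb.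
    rewrite colored_prod_cat colored_prod_cons (app_pmul_centering om).
    rewrite -colored_prod_cat (IHk qs ps) ?mulr0 ?addr0 //; last by move: le_k => /=; lia.
    rewrite -colored_prod_cons -colored_prod_cat -cat_rcons IHq //.
    - by rewrite size_rcons; move: le_k => /=; lia.
    - move: sb; case: (ps) => //= y s; rewrite !rcons_path => /andP[-> /=].
      by rewrite /color_neq.
    - move=> x; rewrite mem_rcons inE => /orP[/eqP ->|/cps //].
      exact: centered_centering.
  case/lastP: ps => [|ps a] in le_k sps cps center_b *.
    exact: center_b.
  have [eab|nab] := eqVneq a.1 b.1; last first.
    apply: center_b; move: sps; case: (ps) => [|y s] /=; first by rewrite /color_neq nab.
    by rewrite !rcons_path => /andP[-> ->]; rewrite last_rcons /= /color_neq nab.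
  rewrite cat_rcons.
  have -> : colored_prod (ps ++ a :: b :: qs) =
            colored_prod (ps ++ (a.1, pmul a.2 b.2) :: qs).
    rewrite !colored_prod_cat !colored_prod_cons; congr (pmul _ _).
    by rewrite pmulA; congr (pmul _ _); rewrite /colored -eab -pmap_pmul.
  apply: IHk.
  - by move: le_k; rewrite size_rcons /=; lia.
  - by move: sps; case: (ps) => //= y s; rewrite rcons_path => /andP[].
  - by move=> x xps; apply: cps; rewrite mem_rcons inE xps orbT.
move=> w; pose qs := [seq (l.2, pmono R [:: l.1]) | l <- w].
have := main _ qs [::] (leqnn _) isT (fun x => ltac:(by [])).
rewrite cat0s => <-; rewrite -[F w]app_pmono; congr (app F _).
rewrite /qs {qs}; elim: w => //= -[l c] w IHw.
by rewrite colored_prod_cons -IHw /colored /pmap /= /pmul /= mulr1.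
Qed.

End Freeness.

(** * The Schwinger-Dyson equation *)

Section SchwingerDyson.
Variables (R : realType) (n : nat).
Local Notation C := R[i].
Local Notation L := (ltr n).
Local Notation L2 := (ltr2 n).
Implicit Types (p q : 'I_n) (m phi psi : seq L -> C) (om : seq L2 -> C).

(* Derivative of the unitary (u_ij) along left multiplication by the
   infinitesimal rotation in the (p, q) block, see [deriv_letter_delta]. *)
Definition sd_letter p q (l : L) : seq (C * (seq L * seq L)) :=
  let: (i, j, s) := l in
  if s then if i == q then [:: (-1, ([:: (p, j, true)], [::]))] else [::]
  else if i == p then [:: (1, ([::], [:: (q, j, false)]))] else [::].

Definition sd_letter2 p q (l : L2) : seq (C * (seq L2 * seq L2)) :=
  if l.2 then [::]
  else [seq (x.1, (map (@emb n false) x.2.1, map (@emb n false) x.2.2))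
       | x <- sd_letter p q l.1].

Definition schwinger_dyson m := forall p q w,
  bisum (fun x y => m x * m y) (der (sd_letter p q) w) = 0.

Lemma bisum_der_emb p q c B w :
  bisum B (der (sd_letter2 p q) (map (@emb n c) w)) =
  if c then 0
  else bisum (fun x y => B (map (@emb n false) x) (map (@emb n false) y))
             (der (sd_letter p q) w).
Proof.
elim: w B => [|l w IH] B /=; first by rewrite /bisum !big_nil if_same.
rewrite bisum_cat {2}/bisum big_map -/(bisum (fun x y => B (emb c l :: x) y) _) IH.
rewrite {1}/bisum big_map; case: c {IH} => /=; first by rewrite big_nil addr0.
rewrite bisum_cat; congr (_ + _); rewrite /bisum !big_map //.
by apply: eq_bigr => x _ /=; rewrite map_cat.
Qed.

Lemma sorted_color_neq (ps : seq (bool * ncpoly R L)) :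
  sorted (@color_neq R n) ps = sorted (fun a b : bool => a != b) (map fst ps).
Proof. by rewrite sorted_map. Qed.

Section FreeProduct.
Variables (phi psi : seq L -> C) (om : seq L2 -> C).
Hypotheses (free_om : is_free_product phi psi om) (phi1 : phi [::] = 1).

Lemma free_product1 : om [::] = 1.
Proof. by case: free_om => _ _ /(_ [::]) /= -> _ _. Qed.

Lemma free_product_centered ps : ps != [::] -> sorted (@color_neq R n) ps ->
  (forall x, x \in ps -> centered om x) -> app om (colored_prod ps) = 0.
Proof.
case: free_om => _ _ _ _ om_free ps0 sps cps; apply: om_free => // k ltk.
by move/(sortedP (false, [::])): sps; apply.
Qed.

(** An uncentered end factor is harmless: centering it changes the value by a multiple of the
    product over [ps], which vanishes because [ps] is nonempty. *)
Lemma free_product_rcons ps x : ps != [::] -> sorted (@color_neq R n) (rcons ps x) ->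
  (forall y, y \in ps -> centered om y) -> app om (colored_prod (rcons ps x)) = 0.
Proof.
move=> ps0 sps cps; rewrite -cats1 colored_prod_cat colored_prod_cons.
rewrite (app_pmul_centering om) pmul1r pmul1r.
rewrite (free_product_centered ps0) //; last first.
  by case: (ps) sps => //= y s; rewrite rcons_path => /andP[].
rewrite mulr0 addr0 -colored_prod1 -colored_prod_cat cats1.
apply: free_product_centered; first by case: (ps).
  by move: sps; rewrite !sorted_color_neq !map_rcons.
move=> y; rewrite mem_rcons inE => /orP[/eqP ->|/cps //].
exact/centered_centering/free_product1.
Qed.

Lemma free_product_cons ps x : ps != [::] -> sorted (@color_neq R n) (x :: ps) ->
  (forall y, y \in ps -> centered om y) -> app om (colored_prod (x :: ps)) = 0.
Proof.
move=> ps0 sps cps; rewrite colored_prod_cons -[pmul _ _]pmul1l.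
rewrite (app_pmul_centering om) !pmul1l.
rewrite (free_product_centered ps0) //; last exact: path_sorted sps.
rewrite mulr0 addr0 -colored_prod_cons.
apply: free_product_centered => //; first by move: sps; rewrite !sorted_color_neq.
move=> y; rewrite inE => /orP[/eqP ->|/cps //].
exact/centered_centering/free_product1.
Qed.

Lemma free_product_derivation : schwinger_dyson phi -> forall p q w,
  bisum (fun x y => om x * om y) (der (sd_letter2 p q) w) = 0.
Proof.
move=> SDphi p q.
have om_emb w : om (map (@emb n false) w) = phi w by case: free_om.
apply: (@functional_eq0 _ _ om); first exact: free_product1.
  by rewrite /bisum big_nil.
(* [qs] collects the factors to the left of the differentiated one; they multiply the left leg of
   the tensor, the later factors the right leg. A nonempty [qs] kills the left leg, a nonempty
   remainder the right leg; only a lone factor survives. *)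
have main ps qs : sorted (@color_neq R n) (qs ++ ps) ->
    (forall x, x \in qs ++ ps -> centered om x) ->
    app (fun w => bisum (fun x y => app (fun z => om (z ++ x)) (colored_prod qs) * om y)
                        (der (sd_letter2 p q) w)) (colored_prod ps) = 0.
  elim: ps qs => [|x ps IH] qs sqs cqs.
    by rewrite app_pmono /bisum big_nil.
  rewrite colored_prod_cons app_der_pmul; rewrite -cat_rcons in sqs cqs.
  have cq y : y \in qs -> centered om y.
    by move=> yq; apply: cqs; rewrite mem_cat mem_rcons inE yq orbT.
  have cp y : y \in ps -> centered om y.
    by move=> yq; apply: cqs; rewrite mem_cat yq orbT.
  have sqx : sorted (@color_neq R n) (rcons qs x).
    by move: sqs; case: (qs) => [|? ?] //=; rewrite cat_path => /andP[].
  have sxp : sorted (@color_neq R n) (x :: ps).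
    by move: sqs; case: (qs) => [|? ?] //=; rewrite cat_path last_rcons => /andP[].
  rewrite [X in _ + X](_ : _ = 0) ?addr0; last first.
    rewrite -[RHS](IH (rcons qs x)) //; apply: eq_app => w; apply: eq_bisum => a b.
    rewrite -cats1 colored_prod_cat colored_prod1 app_pmul.
    rewrite (app_exchange (fun v z => om ((v ++ z) ++ a))).
    rewrite /app big_distrl /=; apply: eq_bigr => v _; rewrite -mulrA.
    by congr (_ * (_ * _)); apply: eq_bigr => z _; rewrite catA.
  rewrite [colored x]/colored app_pmap; apply: app_eq0 => w.
  rewrite bisum_der_emb; case xE : x.1 => //.
  have [/eqP qs0|qs0] := boolP (qs == [::]); last first.
    apply: bisum0 => a b; apply: app_eq0 => z.
    have := @free_product_rcons qs (false, pmono R a) qs0 _ cq.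
    rewrite -cats1 colored_prod_cat colored_prod1 app_pmul => eq0.
    rewrite [X in X * _](_ : _ = 0) ?mul0r //.
    rewrite -[RHS]eq0; last by move: sqx; rewrite cats1 !sorted_color_neq !map_rcons xE.
    by apply: eq_app => v; rewrite app_pmap app_pmono.
  have [/eqP ps0|ps0] := boolP (ps == [::]); last first.
    apply: bisum0 => a b.
    have := @free_product_cons ps (false, pmono R b) ps0 _ cp.
    rewrite colored_prod_cons app_pmul /colored app_pmap app_pmono => eq0.
    rewrite qs0; under eq_app do rewrite app_pmono.
    rewrite /app; under eq_bigr do rewrite mulrCA.
    rewrite -big_distrr /= [X in _ * X](_ : _ = 0) ?mulr0 //.
    by apply: eq0; move: sxp; rewrite !sorted_color_neq /= xE.
  rewrite -[RHS](SDphi p q w); apply: eq_bisum => a b.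
  by rewrite qs0 ps0 /colored_prod /= !app_pmono cats0 /= !om_emb.
move=> ps _ sps cps; rewrite -[RHS](main ps [::] sps cps).
by apply: eq_app => w; apply: eq_bisum => x y; rewrite app_pmono.
Qed.

End FreeProduct.

Lemma Delta_cons (l : L) w : Delta R (l :: w) = pmul (Delta_ltr R l) (Delta R w).
Proof. by []. Qed.

(** D_pq acts on row indices only, and in Delta(u_ij) = sum_k u_ik u_kj the row index i sits in the
    first copy. Differentiating there for i = p gives 1 (x) sum_k u_qk u_kj, which is 1 (x)
    Delta(u_qj); adjoints behave likewise. *)
Lemma app_der_Delta p q B (w : seq L) :
  app (fun v => bisum B (der (sd_letter2 p q) v)) (Delta R w) =
  bisum (fun a b => app (fun x => app (B x) (Delta R b)) (Delta R a))
        (der (sd_letter p q) w).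
Proof.
elim: w B => [|l w IH] B; first by rewrite app_pmono /bisum !big_nil.
rewrite Delta_cons app_der_pmul bisum_der_cons IH; congr (_ + _); last first.
  apply: eq_bisum => a b; rewrite Delta_cons app_pmul.
  by rewrite [RHS]app_exchange; apply: eq_app => x; rewrite [RHS]app_exchange.
case: l => [[i j] [|]]; rewrite {1}/app big_map.
  under eq_bigr do rewrite mul1r.
  have [->|ne] := eqVneq i q; last first.
    rewrite [RHS]/bisum /= (negbTE ne) big_nil big1 // => k _.
    by rewrite /bisum /sd_letter2 /= (negbTE ne) big_nil.
  rewrite [RHS]/bisum /= eqxx big_seq1 /= Delta_cons pmul1r {2}/app /=.
  rewrite [in RHS]big_map big_distrr; apply: eq_bigr => k _.
  by rewrite /bisum /sd_letter2 /= eqxx big_seq1 /= mul1r.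
under eq_bigr do rewrite mul1r.
have [->|ne] := eqVneq i p; last first.
  rewrite [RHS]/bisum /= (negbTE ne) big_nil big1 // => k _.
  by rewrite /bisum /sd_letter2 /= (negbTE ne) big_nil.
rewrite [RHS]/bisum /= eqxx big_seq1 /= Delta_cons app_pmono app_pmul mul1r {2}/app /=.
rewrite [in RHS]big_map; apply: eq_bigr => k _.
by rewrite /bisum /sd_letter2 /= eqxx big_seq1 /= !mul1r.
Qed.

Lemma schwinger_dyson_free_conv phi psi chi : phi [::] = 1 -> schwinger_dyson phi ->
  is_free_conv phi psi chi -> schwinger_dyson chi.
Proof.
move=> phi1 SDphi [om [free_om chiE]] p q w.
rewrite -[RHS](app0 (Delta R w)); under [RHS]eq_app => v.
  rewrite -(free_product_derivation free_om phi1 SDphi p q v); over.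
rewrite app_der_Delta; apply: eq_bisum => a b; rewrite !chiE /app big_distrl /=.
apply: eq_bigr => x _; rewrite -mulrA big_distrr /=; congr (_ * _).
by apply: eq_bigr => y _; rewrite mulrCA.
Qed.

End SchwingerDyson.

(** * Recursion on words and uniqueness of the tracial solution *)

Section SchwingerDysonRecursion.
Variables (R : realType) (n : nat).
Local Notation C := R[i].
Local Notation L := (ltr n).
Implicit Types (p q : 'I_n) (m : seq L -> C) (v w : seq L) (ws : seq (seq L)).

Definition adjw w : seq L := rev (map (@star_ltr n) w).

(** What remains of the sum over p of D_pq applied to the letters of [w] in u_pj w, with [v] the
    letters already passed. An unstarred u_ik forces p = i. A starred letter with row q and column k
    leaves sum_p u_pj v u_pk^* , which a trace contracts to delta_jk v. *)
Fixpoint sd_rest q (j : 'I_n) v w : seq (C * (seq L * seq L)) :=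
  if w is l :: w' then
    (let: (i, k, s) := l in
     if s then if (i == q) && (j == k) then [:: (-1, (v, w'))] else [::]
     else [:: (1, ((i, j, false) :: v, (q, k, false) :: w'))])
    ++ sd_rest q j (rcons v l) w'
  else [::].

Lemma bisum_sd_rest q j (B : seq L -> seq L -> C) v w :
  (forall k x y, \sum_p B ((p, j, false) :: rcons x (p, k, true)) y
                 = (j == k)%:R * B x y) ->
  \sum_p bisum (fun x y => B ((p, j, false) :: v ++ x) y) (der (sd_letter R p q) w)
  = bisum B (sd_rest q j v w).
Proof.
move=> HB; elim: w v => [|l w IH] v /=.
  by rewrite big1 => [|p _]; rewrite /bisum big_nil.
under eq_bigr do rewrite -[_ ++ _]/(der _ (l :: w)) bisum_der_cons.
rewrite big_split bisum_cat -IH; congr (_ + _); last first.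
  by apply: eq_bigr => p _; apply: eq_bisum => x y; rewrite cat_rcons.
case: l => [[i k] [|]] /=.
  case: (i == q) => /=; last first.
    by rewrite big1 => [|p _]; rewrite /bisum big_nil.
  under eq_bigr do rewrite /bisum big_seq1 /= mulN1r cats1.
  rewrite sumrN HB; case: (j == k); rewrite /bisum ?big_seq1 ?big_nil /=.
    by rewrite mul1r mulN1r.
  by rewrite mul0r oppr0.
rewrite (bigD1 i) //= eqxx {1}/bisum big_seq1 /= big1 ?addr0; last first.
  by move=> p; rewrite eq_sym => /negbTE ->; rewrite /bisum big_nil.
by rewrite /bisum big_seq1 /= cats0 !mul1r.
Qed.

(** The n copies of u_qj w come from differentiating the leading letter u_pj, once for each p. *)
Lemma sd_recursion q j (B : seq L -> seq L -> C) w :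
  (forall k x y, \sum_p B ((p, j, false) :: rcons x (p, k, true)) y
                 = (j == k)%:R * B x y) ->
  \sum_p bisum B (der (sd_letter R p q) ((p, j, false) :: w))
  = n%:R * B [::] ((q, j, false) :: w) + bisum B (sd_rest q j [::] w).
Proof.
move=> HB; rewrite -bisum_sd_rest //.
under eq_bigr do rewrite bisum_der_cons.
rewrite big_split; congr (_ + _) => /=.
under eq_bigr do rewrite eqxx /bisum big_seq1 /= mul1r.
by rewrite sumr_const card_ord mulr_natl.
Qed.

Lemma sd_rest_size q j v w (x : C * (seq L * seq L)) : x \in sd_rest q j v w ->
  [/\ (size x.2.1 + size x.2.2 <= (size v + size w).+1)%N,
      (size x.2.1 <= size v + size w)%N, (size x.2.2 <= size v + size w)%N &
      (0 < size v + size w)%N].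
Proof.
elim: w v => [|l w IH] v //=; rewrite mem_cat => /orP[|/IH]; last first.
  by rewrite size_rcons => -[h1 h2 h3 h4]; split; lia.
case: l => [[i k] [|]] /=; last by rewrite inE => /eqP -> /=; split; lia.
by case: ifP => // _; rewrite inE => /eqP -> /=; split; lia.
Qed.

(* Splitting a word of length a + b into nonempty words of lengths a and b
   decreases this weight, and so does cancelling two letters. *)
Definition weight ws := sumn [seq (size w ^ 2).+1 | w <- ws].

(** With s the length of [w], the new lengths satisfy a + b <= s + 1 and a, b <= s, so a^2 + b^2 <=
    s^2 + 1. The two words weigh at most s^2 + 3, which is less than (s + 1)^2 + 1 because s > 0. *)
Lemma weight_sd_rest q j w ws (x : C * (seq L * seq L)) : x \in sd_rest q j [::] w ->
  (weight (x.2.1 :: x.2.2 :: ws) < weight (((q, j, false) :: w) :: ws))%N.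
Proof.
move/sd_rest_size; rewrite /weight /= add0n => -[].
move: (size _) (size _) (size _) => a b s h1 h2 h3 h4.
by rewrite !expnS !expn0; nia.
Qed.

(** The recursion handles a head word that starts with an unstarred letter. Any other nonempty head
    starts with a starred one; its adjoint ends with an unstarred letter, which a rotation brings to
    the front. *)
Lemma words_ind (Q : seq (seq L) -> Prop) :
  Q [::] -> (forall ws, Q ws -> Q ([::] :: ws)) ->
  (forall v w ws, Q ((v ++ w) :: ws) -> Q ((w ++ v) :: ws)) ->
  (forall ws, Q (map adjw ws) -> Q ws) ->
  (forall q j w ws,
     (forall ws', (weight ws' < weight (((q, j, false) :: w) :: ws))%N -> Q ws') ->
     Q (((q, j, false) :: w) :: ws)) ->
  forall ws, Q ws.
Proof.
move=> Qnil Qempty Qrot Qadj Qstep ws.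
have [k] := ubnP (weight ws); elim: k ws => // k IH ws lt_k.
have Qu v q j w us : (weight ((v ++ (q, j, false) :: w) :: us) < k.+1)%N ->
    Q ((v ++ (q, j, false) :: w) :: us).
  move=> lt_uk; apply: Qrot; rewrite cat_cons; apply: Qstep => ws' lt_w.
  apply: IH; apply: leq_trans lt_w _; move: lt_uk; rewrite /weight /= !size_cat /=.
  by rewrite addnS [(size w + _)%N]addnC.
case: ws lt_k => [//|[|[[i j] [|]] w] ws] lt_k; last exact: (Qu [::]).
  by apply/Qempty/IH; move: lt_k; rewrite /weight /=; lia.
apply: Qadj; rewrite /= /adjw /= rev_cons -cats1; apply: Qu.
move: lt_k; rewrite /weight /= size_cat size_rev size_map /= addn1 -map_comp.
set f := (X in sumn (map X ws)); set g := (X in _ -> (_ + sumn (map X ws) < _)%N).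
by rewrite (@eq_map _ _ g f) // => u; rewrite /f /g /= size_rev size_map.
Qed.

Definition hermitian m := forall w, m (adjw w) = conjc (m w).

(** Polarization: a nonnegative element of [R[i]] is real, and positivity at w, 1 + w and 1 + i w
    separates real and imaginary parts. *)
Lemma state_hermitian m : is_state m -> hermitian m.
Proof.
move=> [_ m1 mpos] w.
have pos_w := mpos (pmono R w).
have pos1 := mpos [:: (1, [::]); (1, w)]; have posi := mpos [:: (1, [::]); ('i%C, w)].
move: pos_w pos1 posi; rewrite /app /pmul /padj /= !big_cons !big_nil /= -/(adjw w).
rewrite !cats0 /= m1.
case: (m w) => a b; case: (m (adjw w)) => c d; case: (m (adjw w ++ w)) => e f.
rewrite /=; simpc => /andP[h1 h2] /andP[h3 h4] /andP[h5 h6].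
by congr (_ +i* _)%C; move: h1 h3 h5 => /eqP ? /eqP ? /eqP ?; lra.
Qed.

(** Traciality moves the last letter to the front, where the relation sum_p u_pk^* u_pj = delta_kj
    applies. *)
Lemma sum_contract m : Unc_functional m -> is_tracial m -> forall j k x,
  \sum_p m ((p, j, false) :: rcons x (p, k, true)) = (j == k)%:R * m x.
Proof.
move=> mU mT j k x; have [h _] := mU [::] x k j; move: h.
rewrite /pprod /= pmul1l pmul1r app_pmul; under eq_app do rewrite app_pmono.
rewrite app_pmap; under eq_app do rewrite map_id.
rewrite /rel1 app_cat app_pconst {1}/app big_map big_enum /= => /eqP.
rewrite mulNr subr_eq0 /delta [k == j]eq_sym => /eqP <-.
by apply: eq_bigr => p _; rewrite mul1r -cats1 -cat_cons mT.
Qed.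

Lemma schwinger_dyson_unique m1 m2 :
  is_state m1 -> is_tracial m1 -> schwinger_dyson m1 ->
  is_state m2 -> is_tracial m2 -> schwinger_dyson m2 -> m1 =1 m2.
Proof.
move=> s1 t1 d1 s2 t2 d2.
have rec m : is_state m -> is_tracial m -> schwinger_dyson m -> forall q j w,
    n%:R * m ((q, j, false) :: w) = - bisum (fun x y => m x * m y) (sd_rest q j [::] w).
  move=> sm tm dm q j w.
  have := @sd_recursion q j (fun x y => m x * m y) w; rewrite big1 => [|p _]; last exact: dm.
  move/(_ _)/esym/eqP; rewrite addr_eq0; case: (sm) => mU -> _.
  rewrite mul1r => /(_ _)/eqP -> // k x y.
  by rewrite -big_distrl /= sum_contract // mulrA.
(* Lists occur because [words_ind], shared with the matrix moments, is stated for them. *)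
have main ws : forall v, v \in ws -> m1 v = m2 v.
  elim/words_ind: ws => [//|ws IH v|v w ws IH u|ws IH v vws|q j w ws IH v].
  - by rewrite inE => /orP[/eqP ->|/IH //]; case: s1 => _ -> _; case: s2.
  - rewrite inE => /orP[/eqP ->|uws]; last by apply: IH; rewrite inE uws orbT.
    by rewrite t1 t2; apply: IH; rewrite inE eqxx.
  - have := IH (adjw v) (map_f _ vws).
    by rewrite !state_hermitian // => /(inv_inj (@conjcK R)).
  have vIH v' : (weight [:: v'] < weight (((q, j, false) :: w) :: ws))%N -> m1 v' = m2 v'.
    by move=> lt_v; apply: (IH [:: v']); rewrite ?inE.
  rewrite inE => /orP[/eqP ->|vws]; last first.
    apply: (IH ws) => //; rewrite /weight /=; lia.
  have n0 : n%:R != 0 :> C by rewrite pnatr_eq0 -lt0n (leq_trans _ (ltn_ord q)).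
  apply: (mulfI n0); rewrite !rec //; congr (- _).
  rewrite /bisum !big_seq; apply: eq_bigr => x /(weight_sd_rest ws) lt_x.
  by rewrite !vIH //; apply: leq_ltn_trans lt_x; rewrite /weight /=; lia.
by move=> v; apply: (main [:: v]); rewrite inE.
Qed.

End SchwingerDysonRecursion.

(** * Blocks of unitary matrices *)

Section AdjointMatrix.
Variables (R : realType) (k : nat).
Local Notation C := R[i].
Implicit Types A B X Y : 'M[C]_k.

Lemma adjmxE A i j : adjmx A i j = conjc (A j i).
Proof. by rewrite !mxE. Qed.

Lemma adjmxM A B : adjmx (A *m B) = adjmx B *m adjmx A.
Proof. by rewrite /adjmx map_mxM trmx_mul. Qed.

Lemma adjmxK : involutive (@adjmx R k).
Proof. by move=> A; apply/matrixP => i j; rewrite !adjmxE conjcK. Qed.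

Lemma adjmxD A B : adjmx (A + B) = adjmx A + adjmx B.
Proof. by apply/matrixP => i j; rewrite !mxE rmorphD. Qed.

Lemma adjmxZ (c : C) A : adjmx (c *: A) = conjc c *: adjmx A.
Proof. by apply/matrixP => i j; rewrite !mxE rmorphM. Qed.

Lemma adjmx1 : adjmx 1%:M = 1%:M :> 'M[C]_k.
Proof. by apply/matrixP => i j; rewrite !mxE rmorph_nat eq_sym. Qed.

Lemma unitary_adj X : unitary X -> unitary (adjmx X).
Proof. by move=> [h1 h2]; split; rewrite adjmxK. Qed.

Lemma unitaryM X Y : unitary X -> unitary Y -> unitary (X *m Y).
Proof.
move=> [x1 x2] [y1 y2]; split; rewrite adjmxM.
  by rewrite mulmxA -[X *m Y *m _]mulmxA y1 mulmx1.
by rewrite mulmxA -[_ *m X]mulmxA x2 mulmx1.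
Qed.

Definition sqnorm (x : 'cV[C]_k) : C := \sum_i `|x i 0| ^+ 2.

(** Operator norm at most 1, expressed on vectors so that products and compressions are
    immediate. *)
Definition contraction A := forall x, sqnorm (A *m x) <= sqnorm x.

Lemma sqnormE (x : 'cV[C]_k) : sqnorm x = ((map_mx conjc x)^T *m x) 0 0.
Proof.
by rewrite mxE; apply: eq_bigr => i _; rewrite sqr_normc !mxE mulrC.
Qed.

Lemma sqnorm_unitary X x : unitary X -> sqnorm (X *m x) = sqnorm x.
Proof.
move=> [_ XX]; rewrite !sqnormE map_mxM trmx_mul -/(adjmx X).
by rewrite mulmxA -[_ *m _ *m X]mulmxA XX mulmx1.
Qed.

Lemma contractionM A B : contraction A -> contraction B -> contraction (A *m B).
Proof. by move=> cA cB x; rewrite -mulmxA (le_trans (cA _)). Qed.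

Lemma contraction_entry A i j : contraction A -> `|A i j| <= 1.
Proof.
move=> /(_ (delta_mx j 0)); rewrite -colE /sqnorm.
have -> : \sum_i0 `|delta_mx j (0 : 'I_1) i0 0| ^+ 2 = 1 :> C.
  rewrite (bigD1 j) //= big1 => [|i0 /negbTE ne]; first by rewrite mxE !eqxx normr1 expr1n addr0.
  by rewrite mxE ne normr0 expr0n.
move=> le1; rewrite -(@ler_pXn2r _ 2) ?nnegrE // expr1n; apply: le_trans le1.
rewrite (bigD1 i) //= mxE lerDl sumr_ge0 // => i0 _; exact: exprn_ge0.
Qed.

Lemma unitary_entry X i j : unitary X -> `|X i j| <= 1.
Proof. by move=> Xu; apply: contraction_entry => x; rewrite sqnorm_unitary. Qed.

Lemma ntr_contraction A : contraction A -> `|ntr A| <= 1.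
Proof.
move=> cA; rewrite /ntr normrM normfV normr_nat.
(* For k = 0 the normalization is by the inverse of 0, which is 0. *)
have [k0|k0] := posnP k.
  by have -> : k%:R = 0 :> C; [rewrite k0|rewrite invr0 mulr0 ler01].
rewrite ler_pdivrMr ?ltr0n // mul1r /mxtrace (le_trans (ler_norm_sum _ _ _)) //.
have -> : k%:R = \sum_(i < k) 1 :> C by rewrite sumr_const card_ord.
rewrite ler_sum // => i _; exact: contraction_entry.
Qed.

Lemma ntr_mulC A B : ntr (A *m B) = ntr (B *m A).
Proof. by rewrite /ntr mxtrace_mulC. Qed.

Lemma ntr_adj A : ntr (adjmx A) = conjc (ntr A).
Proof.
rewrite /ntr /mxtrace fmorph_div rmorph_nat rmorph_sum; congr (_ / _).
by apply: eq_bigr => i _; rewrite adjmxE.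
Qed.

Lemma ntr1 : (0 < k)%N -> ntr (1%:M : 'M[C]_k) = 1.
Proof. by move=> k0; rewrite /ntr mxtrace1 divff // pnatr_eq0 -lt0n. Qed.

End AdjointMatrix.

(** * Words in the blocks and their derivatives *)

Section Blocks.
Variables (R : realType) (n N : nat).
Local Notation C := R[i].
Local Notation L := (ltr n).
Local Notation ix := (@mxvec_index n N).
Implicit Types (X Y A : 'M[C]_(n * N)) (w v : seq L) (p q : 'I_n).

Lemma sum_mxvec_index (V : nmodType) (F : 'I_(n * N) -> V) :
  \sum_k F k = \sum_i \sum_a F (ix i a).
Proof. by rewrite (reindex _ (curry_mxvec_bij _ _)) pair_bigA; apply: eq_bigr => -[]. Qed.

Lemma mxvec_index_eq i a j b : (ix i a == ix j b) = (i == j) && (a == b).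
Proof.
apply/eqP/andP => [e|[/eqP -> /eqP ->] //].
(* The indicator of position (i, a) is recovered from its vectorization, so equal indices come from
   equal positions. *)
pose m : 'M[nat]_(n, N) := \matrix_(x, y) ((x == i) && (y == a) : nat).
have := mxvecE m i a; rewrite e mxvecE !mxE !eqxx /= [j == i]eq_sym [b == a]eq_sym.
by case: (i == j); case: (a == b).
Qed.

Lemma block_adj X i j : block (adjmx X) i j = adjmx (block X j i).
Proof. by apply/matrixP => a b; rewrite !mxE. Qed.

Lemma block_mul X Y i j : block (X *m Y) i j = \sum_k block X i k *m block Y k j.
Proof.
apply/matrixP => a b; rewrite !mxE sum_mxvec_index summxE; apply: eq_bigr => k _.
by rewrite mxE; apply: eq_bigr => c _; rewrite !mxE.
Qed.

Lemma block1 (i j : 'I_n) : block (1%:M : 'M[C]_(n * N)) i j = (i == j)%:R%:M :> 'M[C]_N.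
Proof.
apply/matrixP => a b; rewrite !mxE mxvec_index_eq.
by case: (i == j); case: (a == b).
Qed.

Lemma eval_word_cat (X : 'I_n -> 'I_n -> 'M[C]_N) v w :
  eval_word X (v ++ w) = eval_word X v *m eval_word X w.
Proof. by elim: v => [|l v IH] /=; rewrite ?mul1mx // IH mulmxA. Qed.

Lemma eval_word_adjw (X : 'I_n -> 'I_n -> 'M[C]_N) w :
  eval_word X (adjw w) = adjmx (eval_word X w).
Proof.
elim: w => [|l w IH] /=; first by rewrite adjmx1.
rewrite /adjw /= rev_cons -cats1 eval_word_cat /= mulmx1 -/(adjw w) IH adjmxM.
by case: l => [[i j] [|]] /=; rewrite ?adjmxK.
Qed.

Lemma contraction_block X i j : unitary X -> contraction (block X i j).
Proof.
(* [y] is [x] placed in slot j and padded with zeros; slot i of X y is the block applied to [x], so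
   its norm is at most that of [y]. *)
move=> Xu x; pose y : 'cV[C]_(n * N) :=
  (mxvec (\matrix_(k, b) (if k == j then x b 0 else 0)))^T.
have -> : sqnorm x = sqnorm y.
  rewrite /sqnorm sum_mxvec_index (bigD1 j) //= [X in _ + X]big1 ?addr0.
    by apply: eq_bigr => b _; rewrite mxE mxvecE mxE eqxx.
  move=> k /negbTE ne; rewrite big1 // => b _.
  by rewrite mxE mxvecE mxE ne normr0 expr0n.
rewrite -(sqnorm_unitary y Xu) /sqnorm sum_mxvec_index (bigD1 i) //=.
rewrite [X in X <= _](_ : _ = \sum_a `|(X *m y) (ix i a) 0| ^+ 2).
  by rewrite lerDl sumr_ge0 // => k _; rewrite sumr_ge0 // => b _; exact: exprn_ge0.
apply: eq_bigr => a _; congr (`|_| ^+ 2); rewrite !mxE sum_mxvec_index.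
rewrite [RHS](bigD1 j) //= [X in _ = _ + X]big1 ?addr0.
  by apply: eq_bigr => b _; rewrite !mxE mxvecE mxE eqxx.
by move=> k /negbTE ne; rewrite big1 // => b _; rewrite mxE mxvecE mxE ne mulr0.
Qed.

Lemma eval_ltrE X l : eval_ltr (block X) l =
  if l.2 then block (adjmx X) l.1.2 l.1.1 else block X l.1.1 l.1.2.
Proof. by case: l => [[i j] [|]] //=; rewrite block_adj. Qed.

Lemma contraction_eval X w : unitary X -> contraction (eval_word (block X) w).
Proof.
move=> Xu; elim: w => [x|l w IH] /=; first by rewrite mul1mx.
apply: contractionM IH; rewrite eval_ltrE.
by case: ifP => _; apply: contraction_block => //; exact: unitary_adj.
Qed.

Definition wtr X w : C := ntr (eval_word (block X) w).
Definition wtrs X (ws : seq (seq L)) : C := \prod_(v <- ws) wtr X v.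

Lemma wtr_bound X w : unitary X -> `|wtr X w| <= 1.
Proof. by move=> Xu; apply/ntr_contraction/contraction_eval. Qed.

Lemma wtrs_cons X v ws : wtrs X (v :: ws) = wtr X v * wtrs X ws.
Proof. by rewrite /wtrs big_cons. Qed.

Lemma wtrs_bound X ws : unitary X -> `|wtrs X ws| <= 1.
Proof.
move=> Xu; elim: ws => [|v ws IH]; first by rewrite /wtrs big_nil normr1.
by rewrite wtrs_cons normrM mulr_ile1 // wtr_bound.
Qed.

Lemma wtrC X v w : wtr X (v ++ w) = wtr X (w ++ v).
Proof. by rewrite /wtr !eval_word_cat ntr_mulC. Qed.

Lemma wtr_adjw X w : wtr X (adjw w) = conjc (wtr X w).
Proof. by rewrite /wtr eval_word_adjw ntr_adj. Qed.

Lemma wtrs_adjw X ws : wtrs X (map (@adjw n) ws) = conjc (wtrs X ws).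
Proof.
by rewrite /wtrs big_map rmorph_prod; apply: eq_bigr => v _; rewrite wtr_adjw.
Qed.

(** Derivative at t = 0 of the word evaluated at exp(t A) X, for skew-adjoint [A]. Starred letters
    use - X^* A in place of X^* A^* ; the two agree for skew-adjoint [A], and the former is
    complex-linear in [A], so that matrix units can be inserted. *)
Fixpoint deriv_word A X w : 'M[C]_N :=
  if w is l :: w' then
    (if l.2 then - block (adjmx X *m A) l.1.2 l.1.1 else block (A *m X) l.1.1 l.1.2)
      *m eval_word (block X) w'
    + eval_ltr (block X) l *m deriv_word A X w'
  else 0.

Fixpoint deriv_wtrs A X (ws : seq (seq L)) : C :=
  if ws is v :: ws' then
    ntr (deriv_word A X v) * wtrs X ws' + wtr X v * deriv_wtrs A X ws'
  else 0.

Lemma block_linear (c : C) X Y i j : block (c *: X + Y) i j = c *: block X i j + block Y i j.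
Proof. by apply/matrixP => a b; rewrite !mxE. Qed.

Lemma deriv_word_linear (c : C) A A' X w :
  deriv_word (c *: A + A') X w = c *: deriv_word A X w + deriv_word A' X w.
Proof.
elim: w => [|l w IH] /=; first by rewrite scaler0 addr0.
rewrite IH scalerDr addrACA; congr (_ + _); last by rewrite mulmxDr -scalemxAr.
rewrite scalemxAl -mulmxDl; congr (_ *m _); case: ifP => _.
  by rewrite mulmxDr -scalemxAr block_linear scalerN opprD.
by rewrite mulmxDl -scalemxAl block_linear.
Qed.

Lemma ntr_linear (c : C) (Y Z : 'M[C]_N) : ntr (c *: Y + Z) = c * ntr Y + ntr Z.
Proof. by rewrite /ntr mxtraceD mxtraceZ mulrDl mulrA. Qed.

Lemma deriv_wtrs_linear (c : C) A A' X ws :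
  deriv_wtrs (c *: A + A') X ws = c * deriv_wtrs A X ws + deriv_wtrs A' X ws.
Proof.
elim: ws => [|v ws IH] /=; first by rewrite mulr0 addr0.
by rewrite IH deriv_word_linear ntr_linear; ring.
Qed.

(** The origin of D_pq: the (a, b) matrix unit in block (p, q) acts on a letter by putting
    [delta_mx a b] in place of the tensor sign. *)
Lemma deriv_letter_delta p q a b X (l : L) :
  (if l.2 then - block (adjmx X *m delta_mx (ix p a) (ix q b)) l.1.2 l.1.1
   else block (delta_mx (ix p a) (ix q b) *m X) l.1.1 l.1.2)
  = \sum_(x <- sd_letter R p q l) x.1 *: (eval_word (block X) x.2.1 *m delta_mx a b
                                       *m eval_word (block X) x.2.2).
Proof.
case: l => [[i j] [|]] /=.
  case: eqP => [->|ne]; rewrite ?big_seq1 ?big_nil /= ?mulmx1.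
    rewrite scaleN1r -block_adj; congr (- _); apply/matrixP => c d.
    rewrite !mxE sum_mxvec_index (bigD1 p) //= [X in _ + X]big1 ?addr0.
      by apply: eq_bigr => e _; rewrite !mxE !mxvec_index_eq !eqxx.
    move=> r /negbTE ne; rewrite big1 // => e _.
    by rewrite !mxE !mxvec_index_eq ne mulr0.
  apply/matrixP => c d; rewrite !mxE big1 ?oppr0 // => e _.
  by rewrite !mxE !mxvec_index_eq; case: (i =P q) ne => // _ _; rewrite /= andbF mulr0.
case: eqP => [->|ne]; rewrite ?big_seq1 ?big_nil /= ?mulmx1 ?mul1mx.
  rewrite scale1r; apply/matrixP => c d.
  rewrite !mxE sum_mxvec_index (bigD1 q) //= [X in _ + X]big1 ?addr0.
    by apply: eq_bigr => e _; rewrite !mxE !mxvec_index_eq !eqxx.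
  move=> r /negbTE ne; rewrite big1 // => e _.
  by rewrite !mxE !mxvec_index_eq ne /= andbF mul0r.
apply/matrixP => c d; rewrite !mxE big1 // => e _.
by rewrite !mxE !mxvec_index_eq; case: (i =P p) ne => // _ _; rewrite /= mul0r.
Qed.

Lemma deriv_word_delta p q a b X w :
  deriv_word (delta_mx (ix p a) (ix q b)) X w =
  \sum_(x <- der (sd_letter R p q) w) x.1 *: (eval_word (block X) x.2.1 *m delta_mx a b
                                       *m eval_word (block X) x.2.2).
Proof.
elim: w => [|l w IH] /=; first by rewrite big_nil.
rewrite deriv_letter_delta IH big_cat !big_map /=; congr (_ + _).
  rewrite mulmx_suml; apply: eq_bigr => x _ /=.
  by rewrite eval_word_cat -scalemxAl !mulmxA.
by rewrite mulmx_sumr; apply: eq_bigr => x _ /=; rewrite -scalemxAr !mulmxA.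
Qed.

Lemma mul_delta_mulE (Y Z : 'M[C]_N) a b c d :
  (Y *m delta_mx a b *m Z) c d = Y c a * Z b d.
Proof.
rewrite -mulmxA mxE (bigD1 a) //= [X in _ + X]big1 ?addr0 => [|e /negbTE ne].
  congr (_ * _); rewrite mxE (bigD1 b) //= [X in _ + X]big1 ?addr0 => [|e /negbTE ne].
    by rewrite mxE !eqxx mul1r.
  by rewrite mxE ne andbF mul0r.
rewrite [X in _ * X](_ : _ = 0) ?mulr0 // mxE big1 // => f _.
by rewrite mxE ne mul0r.
Qed.

(** The (a, b) entry of x E_ab y is x_aa y_bb, so the double sum splits into two unnormalized
    traces. *)
Lemma sum_deriv_word_delta p q X w : (0 < N)%N ->
  \sum_a \sum_b deriv_word (delta_mx (ix p a) (ix q b)) X w a b =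
  N%:R ^+ 2 * bisum (fun x y => wtr X x * wtr X y) (der (sd_letter R p q) w).
Proof.
move=> N0; have NN : N%:R != 0 :> C by rewrite pnatr_eq0 -lt0n.
rewrite /bisum big_distrr /=.
under eq_bigr => a _.
  under eq_bigr => b _.
    rewrite deriv_word_delta summxE.
    under eq_bigr => x _ do rewrite mxE mul_delta_mulE.
    over.
  rewrite exchange_big /=.
  under eq_bigr => x _.
    rewrite -big_distrr /= -big_distrr /=.
    over.
  over.
rewrite exchange_big; apply: eq_bigr => x _ /=.
rewrite -big_distrr -big_distrl /= /wtr /ntr /mxtrace.
move: (\sum_i _) (\sum_i _) => s t; field.
by rewrite NN.
Qed.

(** Here the sum over a, b closes the product into the single trace of W y x. The 1/N inside [ntr]
    is used up by its normalization, so no power of N is gained. *)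
Lemma sum_mul_deriv_word_delta p q X (W : 'M[C]_N) v :
  \sum_a \sum_b W a b * ntr (deriv_word (delta_mx (ix p a) (ix q b)) X v) =
  bisum (fun x y => ntr (W *m eval_word (block X) y *m eval_word (block X) x))
        (der (sd_letter R p q) v).
Proof.
have E a b : W a b * ntr (deriv_word (delta_mx (ix p a) (ix q b)) X v) =
    \sum_(x <- der (sd_letter R p q) v) x.1 * (W a b *
       (eval_word (block X) x.2.2 *m eval_word (block X) x.2.1) b a / N%:R).
  rewrite deriv_word_delta /ntr raddf_sum /= mulr_suml mulr_sumr.
  apply: eq_bigr => x _; rewrite mxtraceZ.
  rewrite [\tr _](_ : _ = (eval_word (block X) x.2.2 *m eval_word (block X) x.2.1) b a).
    by rewrite -[x.1 * _ / _]mulrA mulrCA !mulrA.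
  by rewrite /mxtrace mxE; apply: eq_bigr => c _; rewrite mul_delta_mulE mulrC.
under eq_bigr => a _ do under eq_bigr => b _ do rewrite E.
under eq_bigr => a _ do rewrite exchange_big.
rewrite exchange_big; apply: eq_bigr => x _ /=.
under eq_bigr => a _ do rewrite -big_distrr /= -big_distrl /=.
rewrite -big_distrr -big_distrl /=; congr (_ * (_ / _)).
by apply: eq_bigr => a _; rewrite -mulmxA [RHS]mxE.
Qed.

(** Each letter contributes at most one term, with coefficient 1 or -1. *)
Lemma bisum_der_bound p q (B : seq L -> seq L -> C) v :
  (forall x y, `|B x y| <= 1) -> `|bisum B (der (sd_letter R p q) v)| <= (size v)%:R.
Proof.
elim: v B => [|l v IH] B HB; first by rewrite /bisum big_nil normr0.
rewrite bisum_der_cons (le_trans (ler_normD _ _)) // /= -nat1r lerD ?IH //.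
case: l => [[i j] [|]] /=; case: ifP => _; rewrite /bisum ?big_seq1 ?big_nil ?normr0 ?ler01 //=.
  by rewrite mulN1r normrN.
by rewrite mul1r.
Qed.

Lemma sum_mul_deriv_wtrs_delta p q X w ws : unitary X ->
  `|\sum_a \sum_b eval_word (block X) w a b
                 * deriv_wtrs (delta_mx (ix p a) (ix q b)) X ws|
  <= (sumn (map size ws))%:R.
Proof.
move=> Xu; elim: ws => [|v ws IH] /=.
  rewrite big1 ?normr0 // => a _; rewrite big1 // => b _; exact: mulr0.
rewrite [X in `|X|](_ : _ =
  (\sum_a \sum_b eval_word (block X) w a b
     * ntr (deriv_word (delta_mx (ix p a) (ix q b)) X v)) * wtrs X ws
  + wtr X v * (\sum_a \sum_b eval_word (block X) w a b
                 * deriv_wtrs (delta_mx (ix p a) (ix q b)) X ws)); last first.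
  rewrite mulr_suml mulr_sumr -big_split; apply: eq_bigr => a _ /=.
  rewrite mulr_suml mulr_sumr -big_split; apply: eq_bigr => b _ /=; ring.
rewrite (le_trans (ler_normD _ _)) //.
rewrite natrD; apply: lerD; rewrite normrM.
  rewrite -[leRHS]mulr1; apply: ler_pM => //; last exact: wtrs_bound.
  rewrite sum_mul_deriv_word_delta; apply: bisum_der_bound => x y.
  by rewrite -!eval_word_cat; exact: wtr_bound.
by rewrite -[leRHS]mul1r ler_pM // wtr_bound.
Qed.

End Blocks.

(** * Infinitesimal left translations *)

Section Rotations.
Variables (R : realType) (k : nat).
Local Notation C := R[i].
Local Notation rc := (real_complex R).
Implicit Types (A X : 'M[C]_k) (F G : 'M[C]_k -> C) (s : R).

(* This is exp (t A) with s = sin t when A ^ 3 = - A. *)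
Definition rotmx A s : 'M[C]_k :=
  1%:M + rc s *: A + rc (1 - Num.sqrt (1 - s ^+ 2)) *: (A *m A).

Definition rotation_generator A := adjmx A = - A /\ A *m A *m A = - A.

Lemma unitary_rotmx A s : rotation_generator A -> 0 <= s <= 1 -> unitary (rotmx A s).
Proof.
move=> [skewA cubeA] /andP[s0 s1]; rewrite /rotmx.
set b := rc (1 - _); set a := rc s.
(* With a = sin t and b = 1 - cos t this is sin^2 + cos^2 = 1, to which unitarity reduces. *)
have ab : 2%:R * b - b * b = a * a.
  rewrite /a /b -(rmorph_nat rc) -!rmorphM -rmorphB; congr (rc _).
  have := sqr_sqrtr (_ : 0 <= 1 - s ^+ 2); move/(_ ltac:(nra)).
  by move: (Num.sqrt _) => c; rewrite -expr2; nra.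
have aJ : conjc a = a by rewrite conjc_real.
have bJ : conjc b = b by rewrite conjc_real.
have adjA : adjmx (1%:M + a *: A + b *: (A *m A)) = 1%:M - a *: A + b *: (A *m A).
  by rewrite !adjmxD !adjmxZ adjmxM adjmx1 skewA aJ bJ mulNmx mulmxN opprK scalerN.
have QQ : (A *m A) *m (A *m A) = - (A *m A) by rewrite mulmxA cubeA mulNmx.
have AQ : A *m (A *m A) = - A by rewrite mulmxA.
rewrite /unitary adjA; clearbody a b; move: cubeA AQ QQ.
have [Q AA] : exists Q, A *m A = Q by exists (A *m A).
rewrite AA => QA AQ QQ; split;
  rewrite !(mulmxDl, mulmxDr, mulmxN, mulNmx, mul1mx, mulmx1);
  rewrite -!(scalemxAl, scalemxAr) AA QA AQ QQ; apply/matrixP => i j; rewrite !mxE;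
  apply/eqP; rewrite -subr_eq0; apply/eqP;
  transitivity ((2%:R * b - b * b - a * a) * Q i j); try ring; by rewrite ab subrr mul0r.
Qed.

(** [F] is a polynomial in the entries of X and their conjugates, [G] its derivative along [A].
    Recording how [F] is built lets boundedness, measurability and the Taylor bound each follow by
    induction; [PolyExt] permits pointwise rewriting. *)
Inductive poly_deriv A : ('M[C]_k -> C) -> ('M[C]_k -> C) -> Prop :=
| PolyCst c : poly_deriv A (fun=> c) (fun=> 0)
| PolyEntry i j : poly_deriv A (fun X => X i j) (fun X => (A *m X) i j)
| PolyConj F G : poly_deriv A F G ->
    poly_deriv A (fun X => conjc (F X)) (fun X => conjc (G X))
| PolyAdd F1 F2 G1 G2 : poly_deriv A F1 G1 -> poly_deriv A F2 G2 ->
    poly_deriv A (fun X => F1 X + F2 X) (fun X => G1 X + G2 X)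
| PolyMul F1 F2 G1 G2 : poly_deriv A F1 G1 -> poly_deriv A F2 G2 ->
    poly_deriv A (fun X => F1 X * F2 X) (fun X => G1 X * F2 X + F1 X * G2 X)
| PolyExt F1 F2 G1 G2 : F1 =1 F2 -> G1 =1 G2 -> poly_deriv A F1 G1 ->
    poly_deriv A F2 G2.

Lemma poly_deriv_sum A (I : Type) (r : seq I) (F G : I -> 'M[C]_k -> C) :
  (forall i, poly_deriv A (F i) (G i)) ->
  poly_deriv A (fun X => \sum_(i <- r) F i X) (fun X => \sum_(i <- r) G i X).
Proof.
move=> FG; elim: r => [|i r IH].
  by apply: PolyExt (PolyCst A 0) => X; rewrite big_nil.
by apply: PolyExt (PolyAdd (FG i) IH) => X; rewrite big_cons.
Qed.

Definition bounded_on_unitary F := exists K, forall X, unitary X -> `|F X| <= K.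

Lemma bounded_entry A i j : bounded_on_unitary (fun X => (A *m X) i j).
Proof.
exists (\sum_l `|A i l|) => X Xu; rewrite mxE (le_trans (ler_norm_sum _ _ _)) //.
apply: ler_sum => l _; rewrite normrM -[leRHS]mulr1 ler_pM //; exact: unitary_entry.
Qed.

Lemma bounded_add F G : bounded_on_unitary F -> bounded_on_unitary G ->
  bounded_on_unitary (fun X => F X + G X).
Proof.
move=> [K hK] [K' hK']; exists (K + K') => X Xu.
by rewrite (le_trans (ler_normD _ _)) // lerD ?hK ?hK'.
Qed.

Lemma bounded_mul F G : bounded_on_unitary F -> bounded_on_unitary G ->
  bounded_on_unitary (fun X => F X * G X).
Proof.
move=> [K hK] [K' hK']; exists (K * K') => X Xu.
by rewrite normrM ler_pM ?hK ?hK'.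
Qed.

Lemma poly_deriv_bounded A F G : poly_deriv A F G ->
  bounded_on_unitary F /\ bounded_on_unitary G.
Proof.
elim => {F G} [c|i j|F G _ [[K hK] [K' hK']]|F1 F2 G1 G2 _ [? ?] _ [? ?]
  |F1 F2 G1 G2 _ [? ?] _ [? ?]|F1 F2 G1 G2 eF eG _ [[K hK] [K' hK']]].
- by split; [exists (`|c|)|exists 0 => X _; rewrite normr0].
- by split; [exists 1 => X; exact: unitary_entry|exact: bounded_entry].
- by split; [exists K|exists K'] => X Xu; rewrite normcJ ?hK ?hK'.
- by split; exact: bounded_add.
- by split; [exact: bounded_mul|apply: bounded_add; exact: bounded_mul].
- by split; [exists K|exists K'] => X Xu; rewrite -?eF -?eG ?hK ?hK'.
Qed.

(** Taylor bound with one constant for all unitary X and all s, so that it survives taking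
    expectations. *)
Lemma poly_deriv_expansion A F G : rotation_generator A -> poly_deriv A F G ->
  exists K, forall s, 0 < s <= 1 -> forall X, unitary X ->
    `|F (rotmx A s *m X) - F X - rc s * G X| <= K * rc s ^+ 2.
Proof.
move=> genA; have rc_ge0 s : 0 < s <= 1 -> 0 <= rc s.
  by move=> /andP[s0 _]; rewrite -(rmorph0 rc) lecR ltW.
have rot_unitary s X : 0 < s <= 1 -> unitary X -> unitary (rotmx A s *m X).
  by move=> /andP[/ltW s0 s1] Xu; apply: unitaryM => //; apply: unitary_rotmx; rewrite ?s0.
elim => {F G} [c|i j|F G _ [K hK]|F1 F2 G1 G2 _ [K1 h1] _ [K2 h2]
  |F1 F2 G1 G2 FG1 [K1 h1] FG2 [K2 h2]|F1 F2 G1 G2 eF eG _ [K hK]].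
- exists 0 => s hs X _; by rewrite subrr mulr0 subrr normr0 mul0r.
- have [K hK] := bounded_entry (A *m A) i j; exists K => s hs X Xu.
  rewrite /rotmx !mulmxDl mul1mx -!scalemxAl.
  have -> : (X + rc s *: (A *m X) + rc (1 - Num.sqrt (1 - s ^+ 2)) *: (A *m A *m X)) i j
      - X i j - rc s * (A *m X) i j = rc (1 - Num.sqrt (1 - s ^+ 2)) * (A *m A *m X) i j.
    by move: (A *m X) (A *m A *m X) => Y Z; rewrite !mxE; ring.
  (* The scalar is at most s^2: for c = sqrt(1 - s^2) in [0, 1], 1 - c <= 1 - c^2. *)
  rewrite normrM mulrC ler_pM ?hK // -rmorphXn.
  have s2 : 0 <= 1 - s ^+ 2 <= 1 by move: hs => /andP[h0 h1]; apply/andP; split; nra.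
  have sq0 := sqrtr_ge0 (1 - s ^+ 2); have := sqr_sqrtr (proj1 (andP s2)).
  move: s2 sq0; move: (Num.sqrt _) => c /andP[s20 s21] c0 c2.
  by rewrite ger0_norm ?lecR -?(rmorph0 rc) ?lecR; nra.
- exists K => s hs X Xu; rewrite -(conjc_real s) -[conjc (rc s) * _]rmorphM -!rmorphB.
  by rewrite normcJ conjc_real hK.
- exists (K1 + K2) => s hs X Xu; rewrite mulrDl.
  apply: le_trans (lerD (h1 s hs X Xu) (h2 s hs X Xu)).
  apply: le_trans (ler_normD _ _); rewrite le_eqVlt; apply/orP; left.
  by apply/eqP; congr (`|_|); ring.
- have [[B1 b1] [D1 d1]] := poly_deriv_bounded FG1.
  have [[B2 b2] [D2 d2]] := poly_deriv_bounded FG2.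
  (* The three summands bound the remainder of [F1], the remainder of [F2] and the second-order
     cross term. *)
  exists (K1 * B2 + (B1 + D1) * K2 + D1 * D2) => s hs X Xu.
  have s0 := rc_ge0 s hs; have s1 : rc s <= 1.
    by rewrite -(rmorph1 rc) lecR; case/andP: hs.
  have Yu := rot_unitary s X hs Xu; set Y := rotmx A s *m X in Yu *.
  have {}h1 := h1 s hs X Xu; have {}h2 := h2 s hs X Xu; rewrite -/Y in h1 h2.
  have -> : F1 Y * F2 Y - F1 X * F2 X - rc s * (G1 X * F2 X + F1 X * G2 X) =
     (F1 Y - F1 X - rc s * G1 X) * F2 Y
     + (F1 X + rc s * G1 X) * (F2 Y - F2 X - rc s * G2 X)
     + rc s ^+ 2 * (G1 X * G2 X) by ring.
  rewrite (le_trans (ler_normD _ _)) // [leRHS]mulrDl lerD //; last first.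
    rewrite normrM normrX (ger0_norm s0) [leLHS]mulrC.
    by apply: ler_wpM2r; rewrite ?exprn_ge0 // normrM ler_pM ?d1 ?d2.
  rewrite (le_trans (ler_normD _ _)) // [leRHS]mulrDl; apply: lerD; rewrite normrM.
    by rewrite mulrAC ler_pM // b2.
  rewrite -mulrA ler_pM // (le_trans (ler_normD _ _)) // lerD ?b1 //.
  by rewrite normrM (ger0_norm s0) -[leRHS]mul1r ler_pM // d1.
- by exists K => s hs X Xu; rewrite -!eF -eG hK.
Qed.

End Rotations.

(** * Traces of words as polynomials with derivatives *)

Section WordDerivatives.
Variables (R : realType) (n N : nat).
Local Notation C := R[i].
Implicit Types (A X : 'M[C]_(n * N)).

Lemma poly_deriv_word A (w : seq (ltr n)) a b : adjmx A = - A ->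
  poly_deriv A (fun X => eval_word (block X) w a b) (fun X => deriv_word A X w a b).
Proof.
move=> skewA; elim: w a b => [|l w IH] a b /=.
  by apply: PolyExt (PolyCst A ((1%:M : 'M[C]_N) a b)) => X //=; rewrite mxE.
have dl c : poly_deriv A (fun X => eval_ltr (block X) l a c)
    (fun X => (if l.2 then - block (adjmx X *m A) l.1.2 l.1.1
               else block (A *m X) l.1.1 l.1.2) a c).
  case: l => [[i j] [|]] /=.
    apply: PolyExt (PolyConj (PolyEntry A (mxvec_index i c) (mxvec_index j a))) => X.
      by rewrite !mxE.
    rewrite -adjmxE adjmxM skewA mulmxN; by rewrite ![in LHS]mxE ![in RHS]mxE.
  by apply: PolyExt (PolyEntry A (mxvec_index i a) (mxvec_index j c)) => X; rewrite [RHS]mxE.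
apply: PolyExt (poly_deriv_sum (index_enum _) (fun c => PolyMul (dl c) (IH c b))) => X.
  by rewrite mxE.
by rewrite 3!mxE -big_split.
Qed.

Lemma poly_deriv_wtrs A (ws : seq (seq (ltr n))) : adjmx A = - A ->
  poly_deriv A (fun X => wtrs X ws) (fun X => deriv_wtrs A X ws).
Proof.
move=> skewA; elim: ws => [|v ws IH].
  by apply: PolyExt (PolyCst A 1) => X //=; rewrite /wtrs big_nil.
have dv : poly_deriv A (fun X => wtr X v) (fun X => ntr (deriv_word A X v)).
  apply: PolyExt (PolyMul (poly_deriv_sum (index_enum _)
    (fun a => poly_deriv_word v a a skewA)) (PolyCst A N%:R^-1)) => X //.
  by rewrite mulr0 addr0.
by apply: PolyExt (PolyMul dv IH) => X //; rewrite wtrs_cons.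
Qed.

End WordDerivatives.

(** * Expectations of complex random variables *)

Section ComplexExpectation.
Variables (R : realType) (d : measure_display) (Omega : measurableType d).
Variable P : probability Omega R.
Local Notation C := R[i].
Implicit Types (Z W : Omega -> C).

Definition integrableC Z :=
  P.-integrable setT (EFin \o (fun x => complex.Re (Z x))) /\
  P.-integrable setT (EFin \o (fun x => complex.Im (Z x))).

Definition EC Z : C :=
  ((\int[P]_x complex.Re (Z x)) +i* (\int[P]_x complex.Im (Z x)))%C.

Lemma eq_EC Z W : Z =1 W -> EC Z = EC W.
Proof. by move=> /funext ->. Qed.

Lemma eq_integrableC Z W : Z =1 W -> integrableC Z -> integrableC W.
Proof. by move=> /funext ->. Qed.

Lemma integrable_scale (f : Omega -> R) (a : R) :
  P.-integrable setT (EFin \o f) -> P.-integrable setT (EFin \o (fun x => a * f x)).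
Proof.
move=> fi; have -> : EFin \o (fun x => a * f x) = (fun x => a%:E * (EFin \o f) x)%E.
  exact/funext.
exact: integrableZl.
Qed.

Lemma integrable_lin (f g : Omega -> R) (a b : R) :
  P.-integrable setT (EFin \o f) -> P.-integrable setT (EFin \o g) ->
  P.-integrable setT (EFin \o (fun x => a * f x + b * g x)).
Proof.
move=> fi gi; have -> : EFin \o (fun x => a * f x + b * g x) =
    ((EFin \o (fun x => a * f x)%R) \+ (EFin \o (fun x => b * g x)%R))%E by exact/funext.
by apply: integrableD => //; apply: integrable_scale.
Qed.

Lemma Rintegral_lin (f g : Omega -> R) (a b : R) :
  P.-integrable setT (EFin \o f) -> P.-integrable setT (EFin \o g) ->
  \int[P]_x (a * f x + b * g x) = a * \int[P]_x f x + b * \int[P]_x g x.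
Proof. by move=> fi gi; rewrite RintegralD ?RintegralZl //; exact: integrable_scale. Qed.

Lemma ReIm_lin (c z w : C) :
  complex.Re (c * z + w) =
    complex.Re c * complex.Re z + (- complex.Im c) * complex.Im z + complex.Re w
  /\ complex.Im (c * z + w) =
    complex.Re c * complex.Im z + complex.Im c * complex.Re z + complex.Im w.
Proof. by case: c => c1 c2; case: z => z1 z2; case: w => w1 w2 /=; split; ring. Qed.

Lemma integrableC_linear (c : C) Z W : integrableC Z -> integrableC W ->
  integrableC (fun x => c * Z x + W x).
Proof.
move=> [Z1 Z2] [W1 W2]; split.
  have -> : (fun x => complex.Re (c * Z x + W x)) = (fun x => 1 *
    (complex.Re c * complex.Re (Z x) + (- complex.Im c) * complex.Im (Z x)) + 1 * complex.Re (W x)).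
    by apply/funext => x; rewrite (ReIm_lin c (Z x) (W x)).1 !mul1r.
  by apply: integrable_lin => //; apply: integrable_lin.
have -> : (fun x => complex.Im (c * Z x + W x)) = (fun x => 1 *
  (complex.Re c * complex.Im (Z x) + complex.Im c * complex.Re (Z x)) + 1 * complex.Im (W x)).
  by apply/funext => x; rewrite (ReIm_lin c (Z x) (W x)).2 !mul1r.
by apply: integrable_lin => //; apply: integrable_lin.
Qed.

Lemma EC_linear (c : C) Z W : integrableC Z -> integrableC W ->
  EC (fun x => c * Z x + W x) = c * EC Z + EC W.
Proof.
move=> [Z1 Z2] [W1 W2]; rewrite /EC.
have -> : \int[P]_x complex.Re (c * Z x + W x) = complex.Re c * \int[P]_x complex.Re (Z x)
    + (- complex.Im c) * \int[P]_x complex.Im (Z x) + \int[P]_x complex.Re (W x).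
  rewrite -Rintegral_lin // -[X in _ + X]mul1r -[X in X + _]mul1r -Rintegral_lin //.
    by congr Rintegral; apply/funext => x; rewrite (ReIm_lin c (Z x) (W x)).1 !mul1r.
  exact: integrable_lin.
have -> : \int[P]_x complex.Im (c * Z x + W x) = complex.Re c * \int[P]_x complex.Im (Z x)
    + complex.Im c * \int[P]_x complex.Re (Z x) + \int[P]_x complex.Im (W x).
  rewrite -Rintegral_lin // -[X in _ + X]mul1r -[X in X + _]mul1r -Rintegral_lin //.
    by congr Rintegral; apply/funext => x; rewrite (ReIm_lin c (Z x) (W x)).2 !mul1r.
  exact: integrable_lin.
by case: c => c1 c2; simpc; congr (_ +i* _)%C; rewrite /= ?mulNr.
Qed.

Lemma integrableC_cst (c : C) : integrableC (fun=> c).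
Proof. by split; apply: finite_measure_integrable_cst. Qed.

Lemma Rintegral_prob_cst (r : R) : Rintegral P setT (fun=> r) = r.
Proof.
rewrite (Rintegral_cst P measurableT) -[RHS]mulr1; congr (_ * _).
exact: (congr1 fine (probability_setT P)).
Qed.

Lemma EC_cst (c : C) : EC (fun=> c) = c.
Proof. by rewrite /EC !Rintegral_prob_cst; case: c. Qed.

Lemma integrableCD Z W : integrableC Z -> integrableC W ->
  integrableC (fun x => Z x + W x).
Proof.
move=> iZ iW; apply: eq_integrableC (integrableC_linear 1 iZ iW) => x.
by rewrite mul1r.
Qed.

Lemma integrableCZ c Z : integrableC Z -> integrableC (fun x => c * Z x).
Proof.
move=> iZ; apply: eq_integrableC (integrableC_linear c iZ (integrableC_cst 0)) => x.
by rewrite addr0.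
Qed.

Lemma ECD Z W : integrableC Z -> integrableC W ->
  EC (fun x => Z x + W x) = EC Z + EC W.
Proof.
move=> iZ iW; rewrite -[EC Z]mul1r -EC_linear //; by apply: eq_EC => x; rewrite mul1r.
Qed.

Lemma ECZ c Z : integrableC Z -> EC (fun x => c * Z x) = c * EC Z.
Proof.
move=> iZ; rewrite -[RHS]addr0 -(EC_cst 0) -EC_linear //; last exact: integrableC_cst.
by apply: eq_EC => x; rewrite addr0.
Qed.

Lemma EC_sum (I : Type) (r : seq I) (Z : I -> Omega -> C) :
  (forall i, integrableC (Z i)) ->
  integrableC (fun x => \sum_(i <- r) Z i x) /\
  EC (fun x => \sum_(i <- r) Z i x) = \sum_(i <- r) EC (Z i).
Proof.
move=> iZ; elim: r => [|i r [IH1 IH2]].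
  split; first by apply: eq_integrableC (integrableC_cst 0) => x; rewrite big_nil.
  by rewrite big_nil -[RHS](EC_cst 0); apply: eq_EC => x; rewrite big_nil.
split; first by apply: eq_integrableC (integrableCD (iZ i) IH1) => x; rewrite big_cons.
rewrite big_cons -IH2 -ECD //; by apply: eq_EC => x; rewrite big_cons.
Qed.

Lemma EC_conj Z : integrableC Z ->
  EC (fun x => conjc (Z x)) = conjc (EC Z).
Proof.
move=> [Z1 Z2]; rewrite /EC.
have -> : (fun x => complex.Re (conjc (Z x))) = (fun x => complex.Re (Z x)).
  by apply/funext => x; case: (Z x).
have -> : (fun x => complex.Im (conjc (Z x))) = (fun x => -1 * complex.Im (Z x)).
  by apply/funext => x; rewrite mulN1r; case: (Z x).
by rewrite RintegralZl // mulN1r.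
Qed.

Lemma EC_ge0 Z : (forall x, 0 <= Z x) -> 0 <= EC Z.
Proof.
move=> Z0; rewrite /EC lecE /=; apply/andP; split.
  apply/eqP; rewrite -[RHS]Rintegral_prob_cst; congr Rintegral; apply/funext => x.
  by have := Z0 x; rewrite lecE => /andP[/eqP /= -> _].
by apply: Rintegral_ge0 => x _; have := Z0 x; rewrite lecE => /andP[].
Qed.

Lemma norm_ReIm (z : C) (K : R) : `|z| <= K%:C%C ->
  `|complex.Re z| <= K /\ `|complex.Im z| <= K.
Proof.
move=> zK; split; rewrite -lecR; apply: le_trans zK; first exact: normc_ge_Re.
(* The imaginary part of z is minus the real part of i z. *)
have := normc_ge_Re (z * 'i%C); rewrite normrM.
rewrite [`|'i%C|](_ : _ = 1); last by rewrite normc_def /= expr0n expr1n add0r sqrtr1.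
by rewrite mulr1; apply: le_trans; case: z => a b; simpc; rewrite /= normrN.
Qed.

(** The factor 2 is the price of bounding real and imaginary parts separately. *)
Lemma EC_norm Z (K : R) : integrableC Z -> (forall x, `|Z x| <= K%:C%C) ->
  `|EC Z| <= (2 * K)%:C%C.
Proof.
move=> [Z1 Z2] ZK.
have bnd (f : Omega -> R) : P.-integrable setT (EFin \o f) -> (forall x, `|f x| <= K) ->
    `|\int[P]_x f x| <= K.
  move=> fi fK; apply: le_trans (le_normr_Rintegral _ _) _ => //.
  rewrite -[leRHS]Rintegral_prob_cst.
  apply: le_Rintegral => //; last exact: finite_measure_integrable_cst.
  exact: (integrable_norm fi).
have -> : EC Z = (\int[P]_x complex.Re (Z x))%:C%C + 'i%C * (\int[P]_x complex.Im (Z x))%:C%C.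
  by rewrite /EC; simpc.
rewrite (le_trans (ler_normD _ _)) // normrM.
rewrite [`|'i%C|](_ : _ = 1); last by rewrite normc_def /= expr0n expr1n add0r sqrtr1.
have nR (x : R) : `|x%:C%C| = (`|x|)%:C%C :> C.
  by rewrite normc_def /= expr0n addr0 sqrtr_sqr.
rewrite mul1r !nR -rmorphD lecR mulr2n mulrDl mul1r lerD // bnd // => x;
  by have [] := norm_ReIm (ZK x).
Qed.

End ComplexExpectation.

(** * Invariance of Haar unitaries *)

Definition mxspace (R : realType) (k : nat) : Type := 'M[R[i]]_k.
HB.instance Definition _ R k := Choice.copy (mxspace R k) ('M[R[i]]_k).
HB.instance Definition _ R k := isPointed.Build (mxspace R k) (0 : 'M[R[i]]_k).
(** A synonym of the matrix type carrying the sigma-algebra of [mx_borel], so that [U] is a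
    measurable function and its law a pushforward. *)
Definition mxborel (R : realType) (k : nat) :=
  g_sigma_algebraType (@mx_coord_sets R k : set (set (mxspace R k))).
HB.instance Definition _ R k := Measurable.on (mxborel R k).


Section MeasurableMatrixFunctions.
Variables (R : realType) (k : nat).
Local Notation C := R[i].
Local Notation MB := (mxborel R k).
Implicit Types (F G : 'M[C]_k -> C).

Definition mxmeasurable F :=
  measurable_fun setT (fun X : MB => complex.Re (F X)) /\
  measurable_fun setT (fun X : MB => complex.Im (F X)).

Lemma eq_mxmeasurable F G : F =1 G -> mxmeasurable F -> mxmeasurable G.
Proof. by move=> /funext ->. Qed.

Lemma mxmeasurable_cst c : mxmeasurable (fun=> c).
Proof. by split; exact: measurable_cst. Qed.

Lemma mxmeasurable_entry i j : mxmeasurable (fun X => X i j).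
Proof.
split=> _ B mB; rewrite setTI; apply: sub_sigma_algebra; exists i, j.
  by exists false, B.
by exists true, B.
Qed.

Lemma mxmeasurable_conj F : mxmeasurable F -> mxmeasurable (fun X => conjc (F X)).
Proof.
move=> [F1 F2]; split.
  rewrite (_ : (fun _ => _) = (fun X : MB => complex.Re (F X))) //.
  by apply/funext => X; case: (F X).
rewrite (_ : (fun _ => _) = (fun X : MB => - complex.Im (F X))); last first.
  by apply/funext => X; case: (F X).
exact: measurableT_comp.
Qed.

Lemma mxmeasurable_add F G : mxmeasurable F -> mxmeasurable G ->
  mxmeasurable (fun X => F X + G X).
Proof.
move=> [F1 F2] [G1 G2]; split.
  rewrite (_ : (fun _ => _) = (fun X : MB => complex.Re (F X) + complex.Re (G X))).
    exact: measurable_funD.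
  by apply/funext => X; case: (F X); case: (G X).
rewrite (_ : (fun _ => _) = (fun X : MB => complex.Im (F X) + complex.Im (G X))).
  exact: measurable_funD.
by apply/funext => X; case: (F X); case: (G X).
Qed.

Lemma mxmeasurable_mul F G : mxmeasurable F -> mxmeasurable G ->
  mxmeasurable (fun X => F X * G X).
Proof.
move=> [F1 F2] [G1 G2]; split.
  rewrite (_ : (fun _ => _) = (fun X : MB =>
    complex.Re (F X) * complex.Re (G X) - complex.Im (F X) * complex.Im (G X))).
    by apply: measurable_funB; apply: measurable_funM.
  by apply/funext => X; case: (F X) => a b; case: (G X).
rewrite (_ : (fun _ => _) = (fun X : MB =>
  complex.Re (F X) * complex.Im (G X) + complex.Im (F X) * complex.Re (G X))).
  by apply: measurable_funD; apply: measurable_funM.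
by apply/funext => X; case: (F X) => a b; case: (G X).
Qed.

Lemma mxmeasurable_mulmx (A : 'M[C]_k) i j : mxmeasurable (fun X => (A *m X) i j).
Proof.
have sumP r : mxmeasurable (fun X => \sum_(l <- r) A i l * X l j).
  elim: r => [|l r IH].
    by apply: eq_mxmeasurable (mxmeasurable_cst 0) => X; rewrite big_nil.
  apply: eq_mxmeasurable (mxmeasurable_add (mxmeasurable_mul
    (mxmeasurable_cst (A i l)) (mxmeasurable_entry l j)) IH) => X.
  by rewrite big_cons.
by apply: eq_mxmeasurable (sumP _) => X; rewrite mxE.
Qed.

Lemma poly_deriv_measurable A F G : poly_deriv A F G -> mxmeasurable F /\ mxmeasurable G.
Proof.
elim => {F G} [c|i j|F G _ [? ?]|F1 F2 G1 G2 _ [? ?] _ [? ?]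
  |F1 F2 G1 G2 _ [? ?] _ [? ?]|F1 F2 G1 G2 eF eG _ [? ?]].
- by split; exact: mxmeasurable_cst.
- by split; [exact: mxmeasurable_entry|exact: mxmeasurable_mulmx].
- by split; exact: mxmeasurable_conj.
- by split; exact: mxmeasurable_add.
- by split; [exact: mxmeasurable_mul|apply: mxmeasurable_add; exact: mxmeasurable_mul].
- by split; [exact: eq_mxmeasurable eF _|exact: eq_mxmeasurable eG _].
Qed.

Lemma measurable_mulmx (V : 'M[C]_k) :
  measurable_fun setT ((fun X => V *m X) : MB -> MB).
Proof.
apply: (@measurability _ _ MB MB setT (fun X => V *m X) (@mx_coord_sets R k)) => //.
move=> _ [_ [i [j [b [B [mB ->]]]]] <-]; have [mRe mIm] := mxmeasurable_mulmx V i j.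
case: b; first exact: (mIm measurableT B mB).
exact: (mRe measurableT B mB).
Qed.

End MeasurableMatrixFunctions.

Section HaarInvariance.
Variables (R : realType) (d : measure_display) (Omega : measurableType d).
Variables (P : probability Omega R) (k : nat) (U : Omega -> 'M[R[i]]_k).
Hypothesis haarU : Haar_distributed P U.
Local Notation C := R[i].
Local Notation MB := (mxborel R k).
Implicit Types (F G : 'M[C]_k -> C) (A : 'M[C]_k).

Lemma Haar_measurable : measurable_fun setT (U : Omega -> MB).
Proof. by case: haarU => _ mU _ _ B mB; rewrite setTI; exact: mU. Qed.

Lemma integrable_of_unitary (V : Omega -> 'M[C]_k) F :
  measurable_fun setT (V : Omega -> MB) -> (forall x, unitary (V x)) ->
  mxmeasurable F -> bounded_on_unitary F -> integrableC P (fun x => F (V x)).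
Proof.
move=> mV Vu [mRe mIm] [K FK].
have bnd x : `|F (V x)| <= (complex.Re K)%:C%C.
  have := FK _ (Vu x); rewrite [X in _ <= X](_ : K = (complex.Re K)%:C%C) //.
  have := le_trans (normr_ge0 _) (FK _ (Vu x)); rewrite lecE /= => /andP[/eqP + _].
  by case: (K) => a b /= ->.
have PT : (P setT < +oo)%E by rewrite probability_setT ltry.
split; apply: measurable_bounded_integrable => //.
- exact: (measurableT_comp mRe mV).
- exists (complex.Re K); split; first by rewrite num_real.
  by move=> M /ltW KM x _ /=; rewrite (le_trans _ KM) //; exact: (norm_ReIm (bnd x)).1.
- exact: (measurableT_comp mIm mV).
- exists (complex.Re K); split; first by rewrite num_real.
  by move=> M /ltW KM x _ /=; rewrite (le_trans _ KM) //; exact: (norm_ReIm (bnd x)).2.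
Qed.

Lemma Haar_integrable F : mxmeasurable F -> bounded_on_unitary F ->
  integrableC P (fun x => F (U x)).
Proof. by apply: integrable_of_unitary; [exact: Haar_measurable|case: haarU]. Qed.

(** By [haarU] the random matrices U and V U have the same law, so both expectations are integrals
    of [F] against equal pushforward measures. *)
Lemma EC_invariant V F : unitary V -> mxmeasurable F -> bounded_on_unitary F ->
  integrableC P (fun x => F (V *m U x)) /\
  EC P (fun x => F (V *m U x)) = EC P (fun x => F (U x)).
Proof.
move=> Vu mF bF; have mU := Haar_measurable.
have mVU : measurable_fun setT ((fun x => V *m U x) : Omega -> MB).
  exact: (measurableT_comp (measurable_mulmx V) mU).
have iVU : integrableC P (fun x => F (V *m U x)).
  apply: (@integrable_of_unitary (fun x => V *m U x)) => // x.
  by apply: unitaryM => //; case: haarU.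
have iU := Haar_integrable mF bF.
have same (f : 'M[C]_k -> R) : measurable_fun setT (f : MB -> R) ->
    P.-integrable setT (EFin \o (fun x => f (U x))) ->
    P.-integrable setT (EFin \o (fun x => f (V *m U x))) ->
    \int[P]_x f (V *m U x) = \int[P]_x f (U x).
  move=> mf i1 i2; congr fine.
  have mEf : measurable_fun setT (EFin \o f : MB -> \bar R).
    exact: measurableT_comp.
  rewrite -[LHS](@integral_pushforward _ _ _ _ _ _ mVU P setT _ mEf) //.
  rewrite -[RHS](@integral_pushforward _ _ _ _ _ _ mU P setT _ mEf) //.
  apply: (@eq_measure_integral _ _ _ _
    (measure_function_pushforward__canonical__measure_function_Measure P mU)
    (measure_function_pushforward__canonical__measure_function_Measure P mVU)).
  move=> A mA _; case: haarU => _ _ invU; exact/esym/invU.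
split => //; rewrite /EC; case: mF iU iVU => mRe mIm [iU1 iU2] [iVU1 iVU2].
by rewrite (same (fun X => complex.Re (F X))) ?(same (fun X => complex.Im (F X))).
Qed.

End HaarInvariance.

(** * Derivatives have expectation zero *)

Section HaarDerivative.
Variables (R : realType) (d : measure_display) (Omega : measurableType d).
Variables (P : probability Omega R) (k : nat) (U : Omega -> 'M[R[i]]_k).
Hypothesis haarU : Haar_distributed P U.
Local Notation C := R[i].
Implicit Types (F G : 'M[C]_k -> C) (A : 'M[C]_k).

Lemma normC_Re (z : C) : `|z| = (complex.Re `|z|)%:C%C.
Proof. by rewrite normc_def. Qed.

Lemma norm_le_small (z : C) (K : R) :
  (forall s, 0 < s <= 1 -> `|z| <= (K * s)%:C%C) -> z = 0.
Proof.
move=> zK; apply/eqP; apply: contraT => z0; have : 0 < `|z| by rewrite normr_gt0.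
have {}zK s : 0 < s <= 1 -> complex.Re `|z| <= K * s.
  by move=> hs; rewrite -lecR -normC_Re; exact: zK.
rewrite normC_Re -(rmorph0 (real_complex R)) ltcR.
move: zK; move: (complex.Re `|z|) => e zK e0.
have [M [M0 KM]] : exists M : R, 0 <= M /\ K <= M by exists `|K|; rewrite ler_norm.
have D0 : 0 < e + M + 1 by lra.
(* At s = e / (e + M + 1) one gets K s <= M s < e, a contradiction. *)
have s1 : e / (e + M + 1) <= 1 by rewrite ler_pdivrMr // mul1r; lra.
have := zK (e / (e + M + 1)); rewrite divr_gt0 // s1 => /(_ isT).
rewrite mulrA ler_pdivlMr //; have := ler_wpM2r (ltW e0) KM.
have ee := mulr_gt0 e0 e0 => h1 h2; suff : False by []; nra.
Qed.

(** By invariance F(rotmx A s U) - F(U) has mean zero, so s |E G(U)| <= 2 K s^2 for all s in (0, 1];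
    divide by s. *)
Lemma EC_deriv A F G : rotation_generator A -> poly_deriv A F G ->
  integrableC P (fun x => G (U x)) /\ EC P (fun x => G (U x)) = 0.
Proof.
move=> genA FG; have [mF mG] := poly_deriv_measurable FG.
have [bF bG] := poly_deriv_bounded FG.
have iF := Haar_integrable haarU mF bF; have iG := Haar_integrable haarU mG bG.
split => //; have [K hK] := poly_deriv_expansion genA FG.
(* [K] lives in [R[i]], but it dominates a norm (take s = 1 and X = 1), hence is real. *)
have Kreal : K = (complex.Re K)%:C%C.
  have := hK 1 ltac:(by rewrite ltr01 lexx) 1%:M ltac:(by split; rewrite adjmx1 mulmx1).
  rewrite rmorph1 expr1n mulr1 => /(le_trans (normr_ge0 _)); rewrite lecE => /andP[/eqP + _].
  by case: (K) => a b /= ->.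
apply: (@norm_le_small _ (2 * complex.Re K)) => s hs; move: (hs) => /andP[s0 s1].
have rotU : unitary (rotmx A s) by apply: unitary_rotmx; rewrite ?(ltW s0).
have [iV eV] := EC_invariant haarU rotU mF bF.
pose sc : C := s%:C%C.
pose r x := -1 * F (U x) + F (rotmx A s *m U x).
have ir : integrableC P r by exact: integrableC_linear.
have Er : EC P r = 0 by rewrite /r EC_linear // eV mulN1r addrC subrr.
have := @EC_norm _ _ _ P (fun x => - sc * G (U x) + r x) (complex.Re K * s ^+ 2)
  (integrableC_linear _ iG ir).
rewrite EC_linear // Er addr0.
have bnd x : `|- sc * G (U x) + r x| <= (complex.Re K * s ^+ 2)%:C%C.
  rewrite rmorphM rmorphXn /= -Kreal; have [Uu _ _] := haarU.
  apply: le_trans (hK s hs (U x) (Uu x)); rewrite le_eqVlt; apply/orP; left; apply/eqP.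
  by congr (`|_|); rewrite /r /sc; ring.
move=> /(_ bnd); rewrite mulNr normrN normrM.
have scE : `|sc| = sc by rewrite ger0_norm // /sc -(rmorph0 (real_complex R)) lecR ltW.
rewrite scE => h; have sc0 : 0 < sc by rewrite /sc -(rmorph0 (real_complex R)) ltcR.
rewrite -(ler_pM2l sc0); apply: le_trans h _; rewrite /sc -rmorphM lecR; lra.
Qed.

End HaarDerivative.

(** * Matrix units as combinations of rotation generators *)

Section RotationGenerators.
Variables (R : realType) (k : nat).
Local Notation C := R[i].
Local Notation E a b := (delta_mx a b : 'M[C]_k).

Lemma adjmx_delta (a b : 'I_k) : adjmx (E a b) = E b a.
Proof. by apply/matrixP => i j; rewrite !mxE rmorph_nat andbC. Qed.

Lemma mulE (a b c e : 'I_k) : E a b *m E c e = (b == c)%:R *: E a e.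
Proof. by rewrite mul_delta_mx_cond scaler_nat. Qed.

Lemma rotation_generator_diag a : rotation_generator ('i%C *: E a a).
Proof.
split; first by rewrite adjmxZ adjmx_delta -scaleNr; congr (_ *: _); simpc.
rewrite -!(scalemxAl, scalemxAr) !mulE eqxx !scale1r !mulE eqxx.
by rewrite scale1r !scalerA -!scaleNr; congr (_ *: _); simpc.
Qed.

Lemma rotation_generator_offdiag (z : C) a b : a != b -> z * conjc z = 1 ->
  rotation_generator (z *: E a b + - conjc z *: E b a).
Proof.
move=> /negbTE ab zz; split.
  rewrite adjmxD !adjmxZ !adjmx_delta opprD -!scaleNr opprK rmorphN /= conjcK addrC.
  by rewrite scaleNr.
have ba : (b == a) = false by rewrite eq_sym.
have -> : (z *: E a b + - conjc z *: E b a) *m (z *: E a b + - conjc z *: E b a)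
    = - (E a a) - E b b.
  rewrite !(mulmxDl, mulmxDr) -!(scalemxAl, scalemxAr) !mulE ab ba !eqxx.
  rewrite !scale1r !scale0r !scaler0 add0r addr0 !scalerA mulNr mulrN.
  by rewrite [conjc z * z]mulrC zz !scaleN1r.
rewrite !(mulmxDl, mulmxDr, mulNmx) -!(scalemxAl, scalemxAr) !mulE ab ba !eqxx.
by rewrite !scale1r !scale0r !scaler0 subr0 oppr0 sub0r opprD.
Qed.

Lemma delta_rotation_generators a b : exists c1 c2 A1 A2,
  [/\ rotation_generator A1, rotation_generator A2 & E a b = c1 *: A1 + c2 *: A2].
Proof.
have [->|ab] := eqVneq a b.
  exists (- 'i%C), 0, ('i%C *: E b b), ('i%C *: E b b).
  split; [exact: rotation_generator_diag|exact: rotation_generator_diag|].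
  by rewrite scale0r addr0 scalerA -[LHS]scale1r; congr (_ *: _); simpc.
(* E_ab is 1/2 times E_ab - E_ba plus -i/2 times i (E_ab + E_ba); these are the generators for z = 1
   and z = i. *)
exists (2^-1), (- 'i%C / 2), (1 *: E a b + - conjc 1 *: E b a),
  ('i%C *: E a b + - conjc 'i%C *: E b a).
split.
- by apply: rotation_generator_offdiag; rewrite // conjc1 mulr1.
- by apply: rotation_generator_offdiag => //; simpc.
rewrite !scalerDr !scalerA addrACA -!scalerDl conjc1.
have ii : 'i%C * 'i%C = -1 :> C by rewrite -expr2 sqr_i.
have -> : conjc 'i%C = - 'i%C :> C by simpc.
have -> : 2^-1 * 1 + - 'i%C / 2 * 'i%C = 1 :> C.
  by rewrite mulrAC mulNr ii opprK mulr1 -[X in X + _]mul1r -splitr.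
have -> : 2^-1 * -1 + - 'i%C / 2 * - - 'i%C = 0 :> C.
  by rewrite opprK mulrAC mulNr ii opprK mulrN1 mul1r addNr.
by rewrite scale1r scale0r addr0.
Qed.

End RotationGenerators.

(** * The Schwinger-Dyson equation at finite N *)

Section FiniteSchwingerDyson.
Variables (R : realType) (d : measure_display) (Omega : measurableType d).
Variables (P : probability Omega R) (n N : nat) (U : Omega -> 'M[R[i]]_(n * N)).
Hypothesis haarU : Haar_distributed P U.
Local Notation C := R[i].
Local Notation L := (ltr n).
Implicit Types (A X : 'M[C]_(n * N)) (w : seq L) (ws : seq (seq L)).

Definition moment ws : C := EC P (fun x => wtrs (U x) ws).

Lemma integrable_wtrs ws : integrableC P (fun x => wtrs (U x) ws).
Proof.
(* Any skew-adjoint direction exhibits [wtrs] as a bounded measurable polynomial; 0 will do. *)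
have D : poly_deriv 0 (fun X => wtrs X ws) (fun X => deriv_wtrs (0 : 'M[C]_(n * N)) X ws).
  by apply: poly_deriv_wtrs; apply/matrixP => i j; rewrite !mxE rmorph0 oppr0.
have [mF _] := poly_deriv_measurable D; have [bF _] := poly_deriv_bounded D.
exact: (Haar_integrable haarU mF bF).
Qed.

(** The integrand is complex-linear in the direction, so its zero mean extends from rotation
    generators to matrix units. *)
Lemma EC_deriv_delta w ws a b i j :
  let G X := deriv_word (delta_mx i j) X w a b * wtrs X ws
             + eval_word (block X) w a b * deriv_wtrs (delta_mx i j) X ws in
  integrableC P (fun x => G (U x)) /\ EC P (fun x => G (U x)) = 0.
Proof.
pose G A X := deriv_word A X w a b * wtrs X ws
              + eval_word (block X) w a b * deriv_wtrs A X ws.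
have linG c A A' X : G (c *: A + A') X = c * G A X + G A' X.
  by rewrite /G deriv_word_linear deriv_wtrs_linear !mxE; ring.
have G0 X : G 0 X = 0.
  by have := linG (-1) 0 0 X; rewrite scaler0 addr0 mulN1r addNr.
have genG A : rotation_generator A ->
    integrableC P (fun x => G A (U x)) /\ EC P (fun x => G A (U x)) = 0.
  move=> genA; have [skewA _] := genA; apply: (EC_deriv haarU genA).
  exact: PolyMul (poly_deriv_word w a b skewA) (poly_deriv_wtrs ws skewA).
have [c1 [c2 [A1 [A2 [g1 g2 ->]]]]] := @delta_rotation_generators R _ i j.
have [i1 e1] := genG _ g1; have [i2 e2] := genG _ g2.
have GE x : c1 * G A1 (U x) + c2 * G A2 (U x) = G (c1 *: A1 + c2 *: A2) (U x).
  by rewrite linG -[c2 *: A2]addr0 linG G0 addr0.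
split; first exact: eq_integrableC GE (integrableC_linear _ i1 (integrableCZ _ i2)).
rewrite -(eq_EC P GE) EC_linear ?ECZ ?e1 ?e2 ?mulr0 ?addr0 //; exact: integrableCZ.
Qed.

(** Sum [EC_deriv_delta] over a, b for the units at (p, a), (q, b). The derivative of [w] gives N^2
    times the product of traces; the derivatives of the traces of [ws] add at most their total
    length, doubled by [EC_norm]. *)
Lemma moment_schwinger_dyson p q w ws : (0 < N)%N ->
  `|bisum (fun x y => moment (x :: y :: ws)) (der (sd_letter R p q) w)|
  <= ((2 * sumn (map size ws))%:R / N%:R ^+ 2)%:C%C.
Proof.
move=> N0; pose ix := @mxvec_index n N.
pose G a b X := deriv_word (delta_mx (ix p a) (ix q b)) X w a b * wtrs X ws
  + eval_word (block X) w a b * deriv_wtrs (delta_mx (ix p a) (ix q b)) X ws.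
pose D X := bisum (fun x y => wtrs X (x :: y :: ws)) (der (sd_letter R p q) w).
have [iD ED] : integrableC P (fun x => D (U x)) /\ EC P (fun x => D (U x)) =
    bisum (fun x y => moment (x :: y :: ws)) (der (sd_letter R p q) w).
  have := @EC_sum _ _ _ P _ (der (sd_letter R p q) w)
    (fun t x => t.1 * wtrs (U x) (t.2.1 :: t.2.2 :: ws))
    (fun t => integrableCZ t.1 (integrable_wtrs _)).
  move=> [h1 h2]; split => //; rewrite [LHS]h2; apply: eq_bigr => t _.
  by rewrite ECZ //; exact: integrable_wtrs.
have [iG EG] : integrableC P (fun x => \sum_a \sum_b G a b (U x)) /\
    EC P (fun x => \sum_a \sum_b G a b (U x)) = 0.
  have h a : integrableC P (fun x => \sum_b G a b (U x)) /\
      EC P (fun x => \sum_b G a b (U x)) = 0.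
    have iab b := (EC_deriv_delta w ws a b (ix p a) (ix q b)).1.
    have [h1 h2] := EC_sum (index_enum _) iab; split => //; rewrite [LHS]h2.
    by rewrite big1 // => b _; exact: (EC_deriv_delta w ws a b (ix p a) (ix q b)).2.
  have [h1 h2] := EC_sum (index_enum _) (fun a => (h a).1); split => //.
  by rewrite [LHS]h2 big1 // => a _; exact: (h a).2.
have GE X : \sum_a \sum_b G a b X = N%:R ^+ 2 * D X + \sum_a \sum_b
    eval_word (block X) w a b * deriv_wtrs (delta_mx (ix p a) (ix q b)) X ws.
  under eq_bigr => a _ do rewrite big_split /= -big_distrl /=.
  rewrite big_split /= -big_distrl /= sum_deriv_word_delta // -mulrA; congr (_ * _ + _).
  rewrite /D /bisum big_distrl /=; apply: eq_bigr => t _.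
  by rewrite !wtrs_cons !mulrA.
have NN : 0 < N%:R ^+ 2 :> R by rewrite exprn_gt0 ?ltr0n.
have := @EC_norm _ _ _ P (fun x => - (N%:R ^+ 2) * D (U x) + \sum_a \sum_b G a b (U x))
  (sumn (map size ws))%:R (integrableC_linear _ iD iG).
rewrite EC_linear // EG addr0 ED => /(_ _)-h.
have {}h := h ltac:(move=> x; rewrite GE mulNr addrA addNr add0r rmorph_nat;
  apply: sum_mul_deriv_wtrs_delta; by case: haarU).
move: h; rewrite mulNr normrN normrM normrX normr_nat.
rewrite -(rmorph_nat (real_complex R)) -rmorphXn natrM.
move: (bisum _ _) => z h.
by move: h; rewrite [`|z|]normC_Re -rmorphM !lecR mulrC => h; rewrite ler_pdivlMr.
Qed.

End FiniteSchwingerDyson.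

(** * Traces of block words as states *)

Section EmpiricalState.
Variables (R : realType) (n N : nat) (X : 'M[R[i]]_(n * N)).
Hypothesis unitaryX : unitary X.
Local Notation C := R[i].
Local Notation L := (ltr n).

Definition eval_poly (p : ncpoly R L) : 'M[C]_N :=
  \sum_(x <- p) x.1 *: eval_word (block X) x.2.

Lemma app_wtr p : app (wtr X) p = ntr (eval_poly p).
Proof.
rewrite /app /eval_poly; elim: p => [|x p IH].
  by rewrite !big_nil /ntr mxtrace0 mul0r.
by rewrite !big_cons ntr_linear IH.
Qed.

Lemma eval_polyM p q : eval_poly (pmul p q) = eval_poly p *m eval_poly q.
Proof.
rewrite /eval_poly /pmul big_allpairs_dep mulmx_suml; apply: eq_bigr => x _.
rewrite mulmx_sumr; apply: eq_bigr => y _ /=.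
by rewrite eval_word_cat -scalemxAl -scalemxAr scalerA.
Qed.

Lemma eval_poly_adj p : eval_poly (padj (@star_ltr n) p) = adjmx (eval_poly p).
Proof.
rewrite /eval_poly /padj big_map; elim: p => [|x p IH].
  by rewrite !big_nil; apply/matrixP => i j; rewrite !mxE rmorph0.
by rewrite !big_cons adjmxD adjmxZ IH /= -/(adjw x.2) eval_word_adjw.
Qed.

Lemma eval_poly_rel1 (i j : 'I_n) : eval_poly (rel1 R i j) = 0.
Proof.
rewrite /eval_poly /rel1 big_cat big_map big_enum big_seq1 /=.
under eq_bigr => k _ do rewrite scale1r mulmx1 -block_adj.
rewrite -block_mul (unitaryX.2) block1 /delta scaleNr.
by rewrite -scalemx1 subrr.
Qed.

Lemma eval_poly_rel2 (i j : 'I_n) : eval_poly (rel2 R i j) = 0.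
Proof.
rewrite /eval_poly /rel2 big_cat big_map big_enum big_seq1 /=.
under eq_bigr => k _ do rewrite scale1r mulmx1 -block_adj.
by rewrite -block_mul (unitaryX.1) block1 /delta scaleNr -scalemx1 subrr.
Qed.

Lemma Unc_wtr : Unc_functional (wtr X).
Proof.
move=> a b i j; rewrite !app_wtr /pprod /= !eval_polyM.
have pmap_id (p : ncpoly R L) : pmap id p = p.
  by rewrite -[RHS]map_id; apply: eq_map => -[c w] /=; rewrite map_id.
rewrite !pmap_id eval_poly_rel1 eval_poly_rel2 !(mul0mx, mulmx0).
by rewrite /ntr mxtrace0 mul0r.
Qed.

Lemma wtr_positive p : 0 <= app (wtr X) (pmul (padj (@star_ltr n) p) p).
Proof.
rewrite app_wtr eval_polyM eval_poly_adj; move: (eval_poly p) => Q.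
rewrite /ntr mulr_ge0 ?invr_ge0 ?ler0n // /mxtrace sumr_ge0 // => i _.
rewrite mxE sumr_ge0 // => j _; rewrite adjmxE mulrC -sqr_normc; exact: exprn_ge0.
Qed.

End EmpiricalState.

(** * Limits of moments *)

Section QuadraticLimits.
Variable R : realType.
Local Notation C := R[i].
Implicit Types (u v : nat -> C) (c : C).

(** N starts at 1 because the empty word has normalized trace 1 only for matrices of positive
    size. *)
Definition qlim u c := exists K : R,
  forall N, (0 < N)%N -> `|u N - c| <= (K / N%:R ^+ 2)%:C%C.

Lemma le0_quadratic (x K : R) :
  (forall N, (0 < N)%N -> x <= K / N%:R ^+ 2) -> x <= 0.
Proof.
move=> h; rewrite leNgt; apply/negP => x0.
have [M [M0 KM]] : exists M : R, 0 <= M /\ K <= M by exists `|K|; rewrite ler_norm.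
have b0 : 0 <= M / x by rewrite divr_ge0 // ltW.
have := archi_boundP b0; set N := Num.bound _ => MN.
have N0 : (0 < N)%N by rewrite -(ltr0n R); apply: le_lt_trans MN.
have N1 : 1 <= N%:R :> R by rewrite ler1n.
have := h N N0; rewrite ler_pdivlMr ?exprn_gt0 ?ltr0n //; apply/negP; rewrite -ltNge.
apply: le_lt_trans KM _; move: MN; rewrite ltr_pdivrMr //; move: (N%:R : R) N1 => t t1; nra.
Qed.

Lemma qlim_unique u c1 c2 : qlim u c1 -> qlim u c2 -> c1 = c2.
Proof.
move=> [K1 h1] [K2 h2]; apply/eqP; rewrite -subr_eq0 -normr_eq0 normC_Re.
suff -> : complex.Re `|c1 - c2| = 0 by rewrite rmorph0.
apply/eqP; rewrite eq_le; apply/andP; split; last first.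
  by rewrite -lecR -normC_Re rmorph0.
apply: (@le0_quadratic _ (K1 + K2)) => N N0; rewrite -lecR -normC_Re mulrDl rmorphD.
apply: le_trans (lerD (h1 N N0) (h2 N N0)); rewrite -[`|u N - c1|]normrN.
by apply: le_trans (ler_normD _ _); rewrite opprB addrA subrK.
Qed.

Lemma qlim_ext u v c : (forall N, (0 < N)%N -> u N = v N) -> qlim u c -> qlim v c.
Proof. by move=> uv [K h]; exists K => N N0; rewrite -uv // h. Qed.

Lemma qlim_cst c : qlim (fun=> c) c.
Proof. by exists 0 => N _; rewrite subrr normr0 mul0r rmorph0. Qed.

Lemma qlim_add u v c1 c2 : qlim u c1 -> qlim v c2 -> qlim (fun N => u N + v N) (c1 + c2).
Proof.
move=> [K1 h1] [K2 h2]; exists (K1 + K2) => N N0; rewrite mulrDl rmorphD.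
apply: le_trans (lerD (h1 N N0) (h2 N N0)).
by apply: le_trans (ler_normD _ _); rewrite opprD addrACA.
Qed.

Lemma qlim_scale a u c : qlim u c -> qlim (fun N => a * u N) (a * c).
Proof.
move=> [K h]; exists (complex.Re `|a| * K) => N N0.
rewrite -mulrBr normrM -mulrA rmorphM /= -normC_Re; apply: ler_wpM2l => //; exact: h.
Qed.

Lemma qlim_conj u c : qlim u c -> qlim (fun N => conjc (u N)) (conjc c).
Proof. by move=> [K h]; exists K => N N0; rewrite -rmorphB normcJ h. Qed.

Lemma qlim_sum (I : eqType) (r : seq I) (u : I -> nat -> C) (c : I -> C) :
  (forall i, i \in r -> qlim (u i) (c i)) ->
  qlim (fun N => \sum_(i <- r) u i N) (\sum_(i <- r) c i).
Proof.
elim: r => [|i r IH] h.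
  by rewrite big_nil; apply: qlim_ext (qlim_cst 0) => N _; rewrite big_nil.
rewrite big_cons; apply: qlim_ext (qlim_add (h i _) (IH _)).
- by move=> N _; rewrite big_cons.
- by rewrite inE eqxx.
- by move=> j jr; apply: h; rewrite inE jr orbT.
Qed.

Lemma qlim_ge0 u c : (forall N, (0 < N)%N -> 0 <= u N) -> qlim u c -> 0 <= c.
Proof.
move=> u0 [K h].
(* In [R[i]] the relation 0 <= c also forces the imaginary part to vanish, hence three real
   inequalities. *)
have ReIm N : (0 < N)%N -> [/\ - complex.Re c <= K / N%:R ^+ 2,
    complex.Im c <= K / N%:R ^+ 2 & - complex.Im c <= K / N%:R ^+ 2].
  move=> N0; have [] := norm_ReIm (h N N0); have := u0 N N0; rewrite lecE.
  case: (u N) => a b; case: (c) => a' b' /= /andP[/eqP -> a0].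
  rewrite sub0r normrN !ler_norml => /andP[h1 h2] /andP[h3 h4]; split; lra.
rewrite lecE; apply/andP; split; last first.
  by rewrite -oppr_le0; apply: (@le0_quadratic _ K) => N /ReIm[].
rewrite eq_le; apply/andP; split; first by apply: (@le0_quadratic _ K) => N /ReIm[].
by rewrite -oppr_le0; apply: (@le0_quadratic _ K) => N /ReIm[].
Qed.

End QuadraticLimits.

(** * Convergence and factorization of the moments *)

Section LimitMoments.
Variables (R : realType) (n : nat) (n_gt0 : (0 < n)%N).
Variables (d : measure_display) (Omega : measurableType d) (P : probability Omega R).
Variable U : forall M : nat, Omega -> 'M[R[i]]_M.
Hypothesis haarU : forall M : nat, (0 < M)%N -> Haar_distributed P (U M).
Local Notation C := R[i].
Local Notation L := (ltr n).
Implicit Types (w v : seq L) (ws : seq (seq L)).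

Let UN N x : 'M[C]_(n * N) := U (n * N)%N x.
Definition mom N ws : C := moment P (@UN N) ws.

Let haarN N : (0 < N)%N -> Haar_distributed P (@UN N).
Proof. by move=> N0; apply: haarU; rewrite muln_gt0 n_gt0. Qed.

Let unitaryN N x : (0 < N)%N -> unitary (@UN N x).
Proof. by move=> /haarN[]. Qed.

Lemma eq_mom N ws ws' : (0 < N)%N ->
  (forall X : 'M[C]_(n * N), unitary X -> wtrs X ws = wtrs X ws') -> mom N ws = mom N ws'.
Proof. by move=> N0 h; apply: eq_EC => x; apply: h; exact: unitaryN. Qed.

Lemma mom_nil N : mom N [::] = 1.
Proof. by rewrite -[RHS](EC_cst P 1); apply: eq_EC => x; rewrite /wtrs big_nil. Qed.

Lemma mom_empty N ws : (0 < N)%N -> mom N ([::] :: ws) = mom N ws.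
Proof. by move=> N0; apply: eq_mom => // X _; rewrite wtrs_cons /wtr ntr1 // mul1r. Qed.

Lemma mom_rot N v w ws : (0 < N)%N -> mom N ((v ++ w) :: ws) = mom N ((w ++ v) :: ws).
Proof. by move=> N0; apply: eq_mom => // X _; rewrite !wtrs_cons wtrC. Qed.

Lemma mom_adj N ws : (0 < N)%N -> mom N (map (@adjw n) ws) = conjc (mom N ws).
Proof.
move=> N0; rewrite -EC_conj; last exact: integrable_wtrs (haarN N0) ws.
by apply: eq_EC => x; rewrite wtrs_adjw.
Qed.

Lemma mom_recursion q j w ws :
  qlim (fun N => n%:R * mom N (((q, j, false) :: w) :: ws) +
        bisum (fun x y => mom N (x :: y :: ws)) (sd_rest R q j [::] w)) 0.
Proof.
pose S := sumn (map size ws); exists (n%:R * (2 * S)%:R) => N N0; rewrite subr0.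
(* An inserted empty word plays the left leg in the first term of [sd_recursion]. *)
rewrite -(mom_empty _ N0) -(@sd_recursion _ _ q j (fun x y => mom N (x :: y :: ws))).
  apply: le_trans (ler_norm_sum _ _ _) _.
  rewrite -mulrA rmorphM rmorph_nat mulr_natl -[n in leRHS]card_ord -sumr_const.
  by apply: ler_sum => p _; exact: moment_schwinger_dyson (haarN N0) _ _ _ _ N0.
move=> k x y.
have iw v : integrableC P (fun t => wtrs (@UN N t) (v :: y :: ws)).
  exact: integrable_wtrs (haarN N0) _.
have [_ <-] := EC_sum (index_enum _) (fun p => iw ((p, j, false) :: rcons x (p, k, true))).
rewrite -ECZ //; apply: eq_EC => t; rewrite wtrs_cons mulrA.
rewrite -(sum_contract (Unc_wtr (unitaryN t N0)) (@wtrC _ _ _ _)) big_distrl /=.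
by apply: eq_bigr => p _; rewrite wtrs_cons.
Qed.

Lemma n_neq0 : n%:R != 0 :> C.
Proof. by rewrite pnatr_eq0 -lt0n. Qed.

Lemma mom_qlim ws : exists c, qlim (mom^~ ws) c.
Proof.
elim/words_ind: ws => [|ws [c h]|v w ws [c h]|ws [c h]|q j w ws IH].
- by exists 1; apply: qlim_ext (qlim_cst 1) => N _; rewrite mom_nil.
- by exists c; apply: qlim_ext h => N N0; rewrite mom_empty.
- by exists c; apply: qlim_ext h => N N0; rewrite mom_rot.
- by exists (conjc c); apply: qlim_ext (qlim_conj h) => N N0; rewrite mom_adj // conjcK.
(* The limits for all lighter lists are chosen at once, with 0 as default for the others. *)
have /choice[f hf] : forall ws', exists c,
    (weight ws' < weight (((q, j, false) :: w) :: ws))%N -> qlim (mom^~ ws') c.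
  move=> ws'; have [lt_w|_] := ltnP (weight ws') (weight (((q, j, false) :: w) :: ws)).
    by have [c h] := IH _ lt_w; exists c.
  by exists 0.
have sumL : qlim (fun N => bisum (fun x y => mom N (x :: y :: ws)) (sd_rest R q j [::] w))
    (bisum (fun x y => f (x :: y :: ws)) (sd_rest R q j [::] w)).
  by apply: qlim_sum => x /(weight_sd_rest ws)/hf h; exact: qlim_scale.
exists (n%:R^-1 * (0 + -1 * bisum (fun x y => f (x :: y :: ws)) (sd_rest R q j [::] w))).
apply: qlim_ext (qlim_scale n%:R^-1 (qlim_add (mom_recursion q j w ws) (qlim_scale (-1) sumL))).
by move=> N _; rewrite mulN1r addrK mulKf // n_neq0.
Qed.

Definition lmom ws : C := xget 0 [set c | qlim (mom^~ ws) c].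

Lemma lmomP ws : qlim (mom^~ ws) (lmom ws).
Proof.
have [c h] := mom_qlim ws.
exact: (@xgetPex _ 0 [set c | qlim (mom^~ ws) c] (ex_intro _ c h)).
Qed.

Lemma lmom_unique ws c : qlim (mom^~ ws) c -> lmom ws = c.
Proof. exact/qlim_unique/lmomP. Qed.

Lemma lmom_nil : lmom [::] = 1.
Proof. by apply: lmom_unique; apply: qlim_ext (qlim_cst 1) => N _; rewrite mom_nil. Qed.

Lemma lmom_empty ws : lmom ([::] :: ws) = lmom ws.
Proof. by apply: lmom_unique; apply: qlim_ext (lmomP ws) => N N0; rewrite mom_empty. Qed.

Lemma lmom_rot v w ws : lmom ((v ++ w) :: ws) = lmom ((w ++ v) :: ws).
Proof. by apply: lmom_unique; apply: qlim_ext (lmomP _) => N N0; rewrite mom_rot. Qed.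

Lemma lmom_adj ws : lmom (map (@adjw n) ws) = conjc (lmom ws).
Proof.
by apply: lmom_unique; apply: qlim_ext (qlim_conj (lmomP ws)) => N N0; rewrite mom_adj.
Qed.

Lemma lmom_bisum ws s :
  qlim (fun N => bisum (fun x y => mom N (x :: y :: ws)) s)
       (bisum (fun x y => lmom (x :: y :: ws)) s).
Proof. by apply: qlim_sum => x _; apply: qlim_scale; exact: lmomP. Qed.

Lemma lmom_recursion q j w ws :
  n%:R * lmom (((q, j, false) :: w) :: ws) =
  - bisum (fun x y => lmom (x :: y :: ws)) (sd_rest R q j [::] w).
Proof.
apply/eqP; rewrite -addr_eq0; apply/eqP; apply: qlim_unique (mom_recursion q j w ws).
by apply: qlim_add (lmom_bisum _ _); apply: qlim_scale; exact: lmomP.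
Qed.

Definition lim_state v : C := lmom [:: v].

(** The recursion splits the head word only and carries [ws] along, so both sides obey the same
    recursion. *)
Lemma lmom_prod ws : lmom ws = \prod_(v <- ws) lim_state v.
Proof.
elim/words_ind: ws => [|ws IH|v w ws IH|ws IH|q j w ws IH].
- by rewrite big_nil lmom_nil.
- by rewrite big_cons lmom_empty IH /lim_state lmom_empty lmom_nil mul1r.
- by rewrite lmom_rot IH !big_cons /lim_state lmom_rot.
- rewrite -[LHS]conjcK -lmom_adj IH big_map rmorph_prod; apply: eq_bigr => v _.
  rewrite /lim_state -[[:: adjw v]]/(map (@adjw n) [:: v]) lmom_adj; exact: conjcK.
apply: (mulfI n_neq0); rewrite big_cons mulrA {1}/lim_state !lmom_recursion mulNr.
congr (- _); rewrite /bisum big_distrl /= [LHS]big_seq [RHS]big_seq.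
apply: eq_bigr => x xs.
rewrite (IH _ (weight_sd_rest ws xs)) (IH [:: x.2.1; x.2.2]); last first.
  by apply: leq_trans (weight_sd_rest [::] xs) _; rewrite /weight /=; lia.
by rewrite !big_cons big_nil mulr1 !mulrA.
Qed.

(** With no further trace to differentiate the finite-N equation is exact; factorization in the
    limit turns it into the product form. *)
Lemma lim_state_SD : schwinger_dyson lim_state.
Proof.
move=> p q w.
have -> : bisum (fun x y => lim_state x * lim_state y) (der (sd_letter R p q) w) =
    bisum (fun x y => lmom [:: x; y]) (der (sd_letter R p q) w).
  by apply: eq_bisum => x y; rewrite lmom_prod !big_cons big_nil mulr1.
apply: qlim_unique (lmom_bisum _ _) _; exists 0 => N N0; rewrite subr0.
have := @moment_schwinger_dyson _ _ _ _ _ _ _ (haarN N0) p q w [::] N0.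
by rewrite /= muln0.
Qed.

Lemma lim_state_tracial : is_tracial lim_state.
Proof. by move=> v w; rewrite /lim_state lmom_rot. Qed.

Lemma app_lim_state (p : ncpoly R L) :
  qlim (fun N => EC P (fun x => app (wtr (@UN N x)) p)) (app lim_state p).
Proof.
apply: qlim_ext (qlim_sum (fun t _ => qlim_scale t.1 (lmomP [:: t.2]))) => N N0.
have i1 v : integrableC P (fun x => wtr (@UN N x) v).
  apply: eq_integrableC (integrable_wtrs (haarN N0) [:: v]) => x.
  by rewrite wtrs_cons /wtrs big_nil mulr1.
have [_ ->] := EC_sum p (fun t => integrableCZ t.1 (i1 t.2)).
apply: eq_bigr => t _; rewrite ECZ //; congr (_ * _); apply: eq_EC => x.
by rewrite wtrs_cons /wtrs big_nil mulr1.
Qed.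

Lemma lim_state_state : is_state lim_state.
Proof.
split.
- move=> a b i j; split; apply: (qlim_unique (app_lim_state _));
    apply: qlim_ext (qlim_cst 0) => N N0; rewrite -[LHS](EC_cst P 0);
    apply: eq_EC => x; have [h1 h2] := Unc_wtr (unitaryN x N0) a b i j.
    by rewrite h1.
  by rewrite h2.
- by rewrite /lim_state lmom_empty lmom_nil.
move=> p; apply: qlim_ge0 (app_lim_state _) => N N0; apply: EC_ge0 => x.
exact: wtr_positive.
Qed.

(** [lim_state] is put first in the convolution, in the copy where the lifted derivation acts; the
    equation then passes to the convolution, which is [h]. *)
Lemma free_Haar_trace_lim_state h : is_free_Haar_trace h -> h =1 lim_state.
Proof.
move=> [sh th absh]; apply: schwinger_dyson_unique => //.
- have [conv _] := absh _ lim_state_state lim_state_tracial.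
  case: lim_state_state => _ l1 _.
  exact: schwinger_dyson_free_conv l1 lim_state_SD conv.
- exact: lim_state_state.
- exact: lim_state_tracial.
- exact: lim_state_SD.
Qed.

End LimitMoments.

(** * Almost sure convergence *)

Section BorelCantelli.
Variables (R : realType) (d : measure_display) (Omega : measurableType d).
Variable P : probability Omega R.

Lemma sum_inv_sqr_le2 k : \sum_(0 <= i < k) (i.+1%:R ^+ 2)^-1 <= 2 :> R.
Proof.
(* The sharper bound telescopes: (t + 1)^-2 <= t^-1 - (t + 1)^-1. *)
have main m : \sum_(0 <= i < m.+1) (i.+1%:R ^+ 2)^-1 <= 2 - m.+1%:R^-1 :> R.
  elim: m => [|m IH]; first by rewrite big_nat1 expr1n invr1; lra.
  rewrite big_nat_recr //=; apply: le_trans (lerD IH (lexx _)) _.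
  have m0 : 0 < m.+1%:R :> R by rewrite ltr0n.
  rewrite -[m.+2]addn1 natrD; move: (m.+1%:R : R) m0 => t t0.
  have -> : (t + 1)^-1 = t^-1 - (t * (t + 1))^-1 by field; lra.
  have : ((t + 1%:R) ^+ 2)^-1 <= (t * (t + 1))^-1.
    by rewrite lef_pV2 ?posrE; nra.
  lra.
case: k => [|k]; first by rewrite big_nil.
by apply: le_trans (main k) _; rewrite gerBl invr_ge0.
Qed.

(** The sum of the f_N has integral at most 2 K, so it is finite almost everywhere, and the terms of
    a convergent series tend to 0. *)
Lemma ae_cvg0_quadratic (f : nat -> Omega -> R) (K : R) :
  (forall N, measurable_fun setT (f N)) -> (forall N x, 0 <= f N x) ->
  (forall N, (\int[P]_x (f N x)%:E <= (K / N.+1%:R ^+ 2)%:E)%E) ->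
  {ae P, forall x, forall e : R, 0 < e ->
     exists N0 : nat, forall N, (N0 <= N)%N -> f N x < e}.
Proof.
move=> mf f0 fK; pose g x : \bar R := (\sum_(0 <= N <oo) (f N x)%:E)%E.
have Ef0 N x : (0 <= (f N x)%:E)%E by rewrite lee_fin.
have mEf N : measurable_fun setT (fun x => (f N x)%:E) by exact: measurableT_comp.
have mg : measurable_fun setT g.
  by apply: (ge0_emeasurable_sum (P := predT)) => // N _; exact: mEf.
have g0 x : (0 <= g x)%E by apply: nneseries_ge0.
have K0 : 0 <= K.
  have : (0 <= (K / 1%:R ^+ 2)%:E)%E.
    by apply: le_trans (fK 0%N); apply: integral_ge0 => x _.
  by rewrite lee_fin expr1n divr1.
have ig : (\int[P]_x g x <= (K * 2)%:E)%E.
  rewrite integral_nneseries //; apply: lime_le.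
    by apply: is_cvg_nneseries => N _ _; apply: integral_ge0 => x _.
  apply: nearW => k; apply: le_trans (_ : (\sum_(0 <= i < k) (K / i.+1%:R ^+ 2)%:E <= _)%E).
    by apply: lee_sum => i _; exact: fK.
  rewrite sumEFin lee_fin -big_distrr /=; apply: ler_wpM2l => //; exact: sum_inv_sqr_le2.
have gi : P.-integrable setT g.
  apply/integrableP; split => //.
  apply: le_lt_trans (ltry (K * 2)); under eq_integral do rewrite gee0_abs //.
  exact: ig.
apply: filterS (integrable_ae measurableT gi) => x /(_ I) gfin e e0.
have bnd k : \sum_(0 <= i < k) f i x <= fine (g x).
  rewrite -lee_fin fineK // -sumEFin; exact: nneseries_lim_ge.
have cvg : cvgn (series (fun i => f i x)).
  apply: nondecreasing_is_cvgn.
    by apply/nondecreasing_seqP => k; rewrite /series /= big_nat_recr //= lerDl.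
  by exists (fine (g x)) => _ [k _ <-]; exact: bnd.
have /cvgrPdist_lt/(_ e e0) [N0 _ h] := cvg_series_cvg_0 cvg.
exists N0 => N leN; have := h N leN; rewrite /= sub0r normrN ger0_norm //.
Qed.

End BorelCantelli.

(** * From the variance bound to polynomials *)

Section AlmostSureConvergence.
Variables (R : realType) (n : nat) (n_gt0 : (0 < n)%N).
Variables (d : measure_display) (Omega : measurableType d) (P : probability Omega R).
Variable U : forall M : nat, Omega -> 'M[R[i]]_M.
Hypothesis haarU : forall M : nat, (0 < M)%N -> Haar_distributed P (U M).
Local Notation C := R[i].
Local Notation mu := (@lim_state R n d Omega P U).

Lemma ae_cvg_word (v : seq (ltr n)) :
  {ae P, forall x, forall e : C, 0 < e -> exists N0 : nat, forall N, (N0 <= N)%N ->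
     `|wtr (U (n * N)%N x : 'M[C]_(n * N)) v - mu v| < e}.
Proof.
pose Z N x : C := wtr (U (n * N)%N x : 'M[C]_(n * N)) v - mu v.
have haarN N : (0 < N)%N -> Haar_distributed P (U (n * N)%N : Omega -> 'M[C]_(n * N)).
  by move=> N0; apply: haarU; rewrite muln_gt0 n_gt0.
(* Expanded so that its expectation is a linear combination of moments; the quadratic term is the
   moment of the list v, v^* . *)
have sqE N x : `|Z N x| ^+ 2 = - mu v * conjc (wtr (U (n * N)%N x : 'M[C]_(n * N)) v)
   + (- conjc (mu v) * wtr (U (n * N)%N x : 'M[C]_(n * N)) v
      + (wtrs (U (n * N)%N x : 'M[C]_(n * N)) [:: v; adjw v] + mu v * conjc (mu v))).
  rewrite sqr_normc /Z rmorphB /= !wtrs_cons /wtrs big_nil mulr1 wtr_adjw; ring.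
have iw N ws : integrableC P (fun x => wtrs (U (n * N.+1)%N x : 'M[C]_(n * N.+1)) ws).
  exact: integrable_wtrs (haarN N.+1 isT) ws.
have iv N w : integrableC P (fun x => wtr (U (n * N.+1)%N x : 'M[C]_(n * N.+1)) w).
  by apply: eq_integrableC (iw N [:: w]) => x; rewrite wtrs_cons /wtrs big_nil mulr1.
have ivc N : integrableC P (fun x => conjc (wtr (U (n * N.+1)%N x : 'M[C]_(n * N.+1)) v)).
  by apply: eq_integrableC (iv N (adjw v)) => x; rewrite wtr_adjw.
have i3 N : integrableC P (fun x => wtrs (U (n * N.+1)%N x : 'M[C]_(n * N.+1)) [:: v; adjw v]
    + mu v * conjc (mu v)) by apply: integrableCD => //; exact: integrableC_cst.
have i2 N := integrableC_linear (- conjc (mu v)) (iv N v) (i3 N).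
have iZ N : integrableC P (fun x => `|Z N.+1 x| ^+ 2).
  apply: eq_integrableC (integrableC_linear (- mu v) (ivc N) (i2 N)) => x.
  by rewrite sqE.
have mom1 N w : EC P (fun x => wtr (U (n * N)%N x : 'M[C]_(n * N)) w) = mom P U N [:: w].
  by apply: eq_EC => x; rewrite wtrs_cons /wtrs big_nil mulr1.
(* In the limit the moment of v, v^* factorizes into mu(v) times its conjugate and everything
   cancels; the rate 1/N^2 is inherited. *)
have [K hK] : qlim (fun N => - mu v * mom P U N [:: adjw v] + (- conjc (mu v) * mom P U N [:: v]
    + (mom P U N [:: v; adjw v] + mu v * conjc (mu v)))) 0.
  have mh : mu (adjw v) = conjc (mu v).
    by apply: state_hermitian; exact: lim_state_state.
  have lP := lmomP n_gt0 haarU.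
  rewrite [X in qlim _ X](_ : 0 = - mu v * mu (adjw v) + (- conjc (mu v) * mu v
      + (lmom P U [:: v; adjw v] + mu v * conjc (mu v)))).
    by do !apply: qlim_add; try apply: qlim_scale; try exact: lP; exact: qlim_cst.
  by rewrite lmom_prod // !big_cons big_nil mulr1 mh; ring.
have EZ N : EC P (fun x => `|Z N.+1 x| ^+ 2) = - mu v * mom P U N.+1 [:: adjw v]
    + (- conjc (mu v) * mom P U N.+1 [:: v]
    + (mom P U N.+1 [:: v; adjw v] + mu v * conjc (mu v))).
  under eq_EC do rewrite sqE.
  rewrite EC_linear // EC_linear // ECD // ?EC_cst; last exact: integrableC_cst.
  rewrite mom1; congr (_ * _ + _); rewrite -mom1; apply: eq_EC => x.
  by rewrite wtr_adjw.
pose f N x : R := complex.Re (`|Z N.+1 x| ^+ 2).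
have fE N x : `|Z N.+1 x| ^+ 2 = (f N x)%:C%C.
  by rewrite /f normC_Re -rmorphXn.
have f0 N x : 0 <= f N x by rewrite -lecR -fE rmorph0 exprn_ge0.
have mf N : measurable_fun setT (f N).
  have [/integrableP[/measurable_EFinP mRe _] _] := iZ N; exact: mRe.
have fK N : (\int[P]_x (f N x)%:E <= (K / N.+1%:R ^+ 2)%:E)%E.
  have [iRe _] := iZ N.
  rewrite -[leLHS]fineK; last exact: integrable_fin_num iRe.
  rewrite lee_fin; have := hK N.+1 isT; rewrite subr0 -EZ => /norm_ReIm[+ _].
  by move=> /(le_trans (ler_norm _)).
apply: filterS (ae_cvg0_quadratic mf f0 fK) => x h e e0.
have eE : e = (complex.Re e)%:C%C.
  by move: e0; rewrite ltcE => /andP[/eqP + _]; case: (e) => a b /= ->.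
have re0 : 0 < complex.Re e by rewrite -ltcR rmorph0 -eE.
(* [f N] concerns matrices of size n (N + 1), hence the shifted threshold. *)
have [N0 hN0] := h _ (exprn_gt0 2 re0); exists N0.+1 => -[//|N] leN.
have := hN0 N leN; rewrite -ltcR -fE rmorphXn /= -eE.
by rewrite ltr_pXn2r // nnegrE // ltW.
Qed.

Lemma ae_cvg_poly (p : ncpoly R (ltr n)) :
  {ae P, forall x, forall e : C, 0 < e -> exists N0 : nat, forall N, (N0 <= N)%N ->
     `|app (wtr (U (n * N)%N x : 'M[C]_(n * N))) p - app mu p| < e}.
Proof.
elim: p => [|[c v] p IH].
  apply: aeW => x e e0; exists 0%N => N _; by rewrite !app_nil subrr normr0.
apply: filterS2 (ae_cvg_word v) IH => x hv hp e e0.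
have e2 : 0 < e / 2 by rewrite divr_gt0.
(* Adding 1 keeps the divisor positive when c = 0. *)
have c1 : 0 < `|c| + 1 by rewrite ltr_wpDl.
have [N1 h1] := hv _ (divr_gt0 e2 c1); have [N2 h2] := hp _ e2.
exists (maxn N1 N2) => N; rewrite geq_max => /andP[/h1 l1 /h2 l2].
rewrite /app !big_cons -!/(app _ _) opprD addrACA -mulrBr /=.
apply: le_lt_trans (ler_normD _ _) _; rewrite [ltRHS]splitr; apply: ler_ltD l2.
rewrite normrM; apply: le_trans (_ : (`|c| + 1) * (e / 2 / (`|c| + 1)) <= _).
  by apply: ler_pM => //; rewrite ?lerDl // ltW.
by rewrite mulrC divfK // gt_eqF.
Qed.

End AlmostSureConvergence.

Theorem mainTheorem12 (R : realType) (n : nat) (hn : (0 < n)%N)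
    (h : seq (ltr n) -> R[i]) (hh : is_free_Haar_trace h)
    (d : measure_display) (Omega : measurableType d) (P : probability Omega R)
    (U : forall M : nat, Omega -> 'M[R[i]]_M)
    (hU : forall M : nat, (0 < M)%N -> Haar_distributed P (U M))
    (p : ncpoly R (ltr n)) :
  {ae P, forall w,
     forall e : R[i], 0 < e -> exists N0 : nat, forall N : nat, (N0 <= N)%N ->
       `| ntr_poly (block (U (n * N)%N w)) p - app h p | < e}.
Proof.
rewrite (eq_app p (free_Haar_trace_lim_state hn hU hh)).
(* [ntr_poly (block X) p] and [app (wtr X) p] are convertible. *)
exact: (ae_cvg_poly hn hU).
Qed.
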